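(* Let $1\leq p<2$. Let $\gamma:[0,1]\rightarrow\mathbb{R}^{2}$ be a continuous closed curve with finite $p$-variation. Let $\eta(\gamma,(x,y))$ denote the winding number of $\gamma$ around $x\mathbf{e}_{1}+y\mathbf{e}_{2}$. Then for all integers $n,k\geq0$, $$\mathbf{e}_{1}^{*\otimes(n+1)}\otimes\mathbf{e}_{2}^{*\otimes(k+1)}\big(S(\gamma)_{0,1}\big)=\frac{(-1)^{k}}{n!\,k!}\int_{\mathbb{R}^{2}}x^{n}y^{k}\,\eta\big(\gamma-\gamma_{0},(x,y)\big)\,\mathrm{d}x\,\mathrm{d}y.$$
   Context: A continuous $\gamma:[0,1]\to\mathbb{R}^2$ has finite $p$-variation if $\sup\sum_k|\gamma_{t_{k+1}}-\gamma_{t_k}|^p<\infty$, the supremum being over all finite partitions; it is closed if $\gamma_0=\gamma_1$. For such $\gamma$ with $1\le p<2$, the signature is $S(\gamma)_{0,1}=1+\sum_{n\ge1}\int_{0<t_1<\cdots<t_n<1}\mathrm{d}\gamma_{t_1}\otimes\cdots\otimes\mathrm{d}\gamma_{t_n}$ (Young integrals), in the space $T((\mathbb{R}^2))$ of sequences $(a_0,a_1,\ldots)$, $a_i\in(\mathbb{R}^2)^{\otimes i}$. $\mathbf{e}_1^*,\mathbf{e}_2^*$ is the basis dual to the standard basis $\mathbf{e}_1,\mathbf{e}_2$ of $\mathbb{R}^2$; $\mathbf{e}_{i_1}^*\otimes\cdots\otimes\mathbf{e}_{i_m}^*$ acts on $T((\mathbb{R}^2))$ by applying $v_1\otimes\cdots\otimes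 v_m\mapsto\mathbf{e}_{i_1}^*(v_1)\cdots\mathbf{e}_{i_m}^*(v_m)$ to the degree-$m$ component. For a continuous closed curve $\gamma$ and $z\in\mathbb{R}^2\setminus\gamma[0,1]$, the winding number is $\eta(\gamma,z)=\frac1{2\pi}(\tilde g(1)-\tilde g(0))$, where $\tilde g:[0,1]\to\mathbb{R}$ is continuous with $e^{i\tilde g(s)}=(\gamma_s-z)/\|\gamma_s-z\|$ (identifying $\mathbb{R}^2$ with $\mathbb{C}$). The image of a curve of finite $p$-variation with $p<2$ is Lebesgue-null, so $\eta(\gamma,\cdot)$ is defined almost everywhere. *)

(* Defs.v *)
From HB Require Import structures.
From mathcomp Require Import all_boot all_order all_algebra.
From mathcomp Require Import all_classical all_reals all_analysis.

Set Implicit Arguments.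
Unset Strict Implicit.
Unset Printing Implicit Defensive.

Import Order.TTheory GRing.Theory Num.Theory.
Import numFieldNormedType.Exports.

Local Open Scope classical_set_scope.
Local Open Scope ring_scope.

(* The library's norm on [R * R] is the sup norm. *)
Definition eucl {R : realType} (v : R * R) : R :=
  Num.sqrt (v.1 ^+ 2 + v.2 ^+ 2).

Definition ebasis {R : realType} (i : 'I_2) : R * R :=
  if i == 0 then (1, 0) else (0, 1).

Definition edual {R : realType} (i : 'I_2) (v : R * R) : R :=
  if i == 0 then v.1 else v.2.

(* When [itv_partition a b s] holds, the subdivision is
   a = t_0 < t_1 < ... < t_(size s) = b, where t_1, ..., t_(size s) are the
   items of [s]; [subdiv a b s k] is t_k. *)
Definition subdiv {R : realType} (a b : R) (s : seq R) (k : nat) : R :=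
  nth b (a :: s) k.

Definition pvar_sum {R : realType} (p a b : R) (gamma : R -> R * R)
    (s : seq R) : R :=
  \sum_(0 <= k < size s)
    eucl (gamma (subdiv a b s k.+1) - gamma (subdiv a b s k)) `^ p.

Definition finite_pvariation {R : realType} (p a b : R)
    (gamma : R -> R * R) : Prop :=
  (ereal_sup [set (pvar_sum p a b gamma s)%:E | s in itv_partition a b]
    < +oo)%E.

(* Tagged subdivisions (s, xi) of [a, b], with t_k <= xi_k <= t_(k+1), as the
   mesh tends to 0. *)
Definition mesh_to0 {R : realType} (a b : R) :
    set_system (seq R * (nat -> R)) :=
  filter_from [set d : R | 0 < d] (fun d => [set P : seq R * (nat -> R) |
    itv_partition a b P.1 /\
    forall k, (k < size P.1)%N ->
      subdiv a b P.1 k <= P.2 k <= subdiv a b P.1 k.+1 /\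
      subdiv a b P.1 k.+1 - subdiv a b P.1 k < d]).

Definition riemann_stieltjes_sum {R : realType} (a b : R) (f g : R -> R)
    (P : seq R * (nat -> R)) : R :=
  \sum_(0 <= k < size P.1)
    f (P.2 k) * (g (subdiv a b P.1 k.+1) - g (subdiv a b P.1 k)).

Definition young_integral {R : realType} (a b : R) (f g : R -> R) : R :=
  lim (riemann_stieltjes_sum a b f g @ mesh_to0 a b).

(* (R^2)^{(x) m}, an element being given by its coordinates in the basis
   e_(w_1) (x) ... (x) e_(w_m), w ranging over the words of length m. *)
Definition tensor (R : realType) (m : nat) : Type :=
  {ffun m.-tuple 'I_2 -> R}.

Definition tensor_series (R : realType) : Type := forall m : nat, tensor R m.

Definition pure_tensor {R : realType} (m : nat) (v : m.-tuple (R * R)) :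
    tensor R m :=
  [ffun w : m.-tuple 'I_2 => \prod_(j < m) edual (tnth w j) (tnth v j)].

(* The linear form e*_(w_1) (x) ... (x) e*_(w_m) on the degree m component:
   the linear extension of its values on the basis tensors. *)
Definition dual_word {R : realType} (m : nat) (w : m.-tuple 'I_2)
    (a : tensor_series R) : R :=
  \sum_(u : m.-tuple 'I_2)
    a m u * \prod_(j < m) edual (tnth w j) (ebasis (tnth u j)).

Lemma edual_ebasis {R : realType} (i j : 'I_2) :
  edual i (ebasis j : R * R) = (i == j)%:R.
Proof. by case: i j => [[|[|//]] ?] [[|[|//]] ?]. Qed.

Lemma dual_wordE {R : realType} (m : nat) (w : m.-tuple 'I_2)
    (a : tensor_series R) : dual_word w a = a m w.
Proof.
rewrite /dual_word (bigD1 w)//= [X in _ * X]big1 ?mulr1; last first.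
  by move=> j _; rewrite edual_ebasis eqxx.
rewrite big1 ?addr0// => u uw.
have [j wuj] : exists j, tnth w j != tnth u j.
  apply/existsP; apply: contraNT uw; rewrite negb_exists => /forallP wu.
  by apply/eqP/eq_from_tnth => j; move: (wu j); rewrite negbK => /eqP ->.
by rewrite (bigD1 j)//= edual_ebasis (negbTE wuj) mul0r mulr0.
Qed.

Lemma dual_word_pure {R : realType} (m : nat) (w : m.-tuple 'I_2)
    (v : m.-tuple (R * R)) (a : tensor_series R) : a m = pure_tensor v ->
  dual_word w a = \prod_(j < m) edual (tnth w j) (tnth v j).
Proof. by move=> av; rewrite dual_wordE av ffunE. Qed.

(* For w = i_1 ... i_m,
     \int_{a < t_1 < ... < t_m < b} d gamma^{i_1}_{t_1} ... d gamma^{i_m}_{t_m},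
   computed as an iterated Young integral: the first letter of w is the
   innermost integration. *)
Definition iterated_integral {R : realType} (a b : R) (gamma : R -> R * R)
    (w : seq 'I_2) : R :=
  foldl (fun (F : R -> R) (i : 'I_2) =>
           fun t => young_integral a t F (edual i \o gamma))
        (fun=> 1) w b.

Definition signature {R : realType} (gamma : R -> R * R) (a b : R) :
    tensor_series R :=
  fun m => [ffun w : m.-tuple 'I_2 => iterated_integral a b gamma w].

Definition angle_lift {R : realType} (gamma : R -> R * R) (z : R * R)
    (g : R -> R) : Prop :=
  {within `[0, 1], continuous g} /\
  forall s, s \in `[0, 1] ->
    cos (g s) = (gamma s - z).1 / eucl (gamma s - z) /\
    sin (g s) = (gamma s - z).2 / eucl (gamma s - z).

(* For z on the curve no lift exists (as x / 0 = 0), and the value is 0. *)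
Definition winding {R : realType} (gamma : R -> R * R) (z : R * R) : R :=
  xget 0 [set (g 1 - g 0) / (2 * pi) | g in angle_lift gamma z].

(* Main.v *)
Require Import Defs.
From HB Require Import structures.
From mathcomp Require Import all_boot all_order all_algebra.
From mathcomp Require Import all_classical all_reals all_analysis.
From mathcomp Require Import measurable_realfun ring lra.
Import Order.TTheory GRing.Theory Num.Theory.
Import numFieldNormedType.Exports.
Local Open Scope classical_set_scope.
Local Open Scope ring_scope.

Set Implicit Arguments.
Unset Strict Implicit.
Unset Printing Implicit Defensive.

(** Write [gamma - gamma 0 = (x, y)].  Finite p-variation with [p < 2] gives a
    nondecreasing [V] and [th > 1] such that products of two increments of
    [gamma] over [[s, t]] are [o((V t - V s) `^ th)]; such terms do not
    contribute to Riemann sums.  Hence every relation [d G = f d g] that holds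
    up to such a term computes a Young integral, and ordinary calculus shows
    that the left-hand side equals [(-1) ^+ k / (n.+1`! * k`!)] times
    [\int_0^1 x ^+ n.+1 * y ^+ k d y].

    On the other side, replace [gamma] on the dyadic subdivision of order [m] by
    a staircase.  Its crossing number [N_m] with horizontal rays is a sum of
    signed indicators of rectangles, so the integral of [x ^+ n * y ^+ k * N_m]
    is a Riemann-Stieltjes sum for the integral above.  Inserting a point [r]
    between [s] and [t] changes the staircase by a rectangle of area
    [`|x r - x s| * `|y t - y r|]; Young's argument, applied in L^1 of the plane
    instead of the reals, shows that [N_m] is Cauchy in (weighted) L^1.  Off
    the curve, which is Lebesgue-null, [N_m] is eventually equal to the winding
    number, and Fatou's lemma concludes. *)

(** * Sewing *)

(** For [p > 1] the curve may have infinite length, so Green's formula does not apply directly, and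
    nothing says in advance that the winding number is measurable, let alone integrable. Both
    properties have to come out of the approximation; this is why the estimate is made in L^1 and
    not only for the integrals. Staircases are preferred to polygons because their crossing number
    is a sum of products of a function of x and a function of y. The weight x^n y^k factors in the
    same way, so Fubini evaluates each term exactly, and inserting a point changes the sum by one
    more such product, in which an increment of x and an increment of y separate. Its L^1 norm is
    then bounded by the same quantity that bounds the defect of a Young sum, and one sewing argument
    serves both sides. *)

Definition young_const {R : realType} (th : R) : R := 2 / (1 - 2 `^ (1 - th)).

Lemma powR2_lt1 {R : realType} (r : R) : r < 0 -> 2 `^ r < 1.
Proof. by move=> r0; rewrite /powR gt_eqF// expR_lt1 nmulr_rlt0// ln_gt0// ltr1n. Qed.

Lemma young_const_ge0 {R : realType} (th : R) : 1 < th -> 0 <= young_const th.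
Proof.
by move=> th1; rewrite divr_ge0// subr_ge0 ltW// powR2_lt1// subr_lt0.
Qed.

(* [B v r] stands for "the seminorm of v is at most r"; it is a relation so that
   the L^1 case can include measurability.  Cutting at the index where the
   control passes half of its total value gives a geometric recursion, since
   [2 * 2 `^ (- th) < 1]. *)
Lemma sewing_bound {R : realType} (th : R) (W : zmodType) (B : W -> R -> Prop)
    (w : nat -> R) (X : nat -> nat -> W) (c : R) (N : nat) :
  1 < th -> 0 <= c ->
  B 0 0 ->
  (forall v v' r r', B v r -> B v' r' -> B (v + v') (r + r')) ->
  (forall v r r', B v r -> r <= r' -> B v r') ->
  (forall i j, (i <= j)%N -> (j <= N)%N -> w i <= w j) ->
  (forall i, X i i = 0) ->
  (forall i j k, (i <= j)%N -> (j <= k)%N -> (k <= N)%N ->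
    B (X i j + X j k - X i k) (c * (w k - w i) `^ th)) ->
  forall a b, (a <= b)%N -> (b <= N)%N ->
  B (\sum_(a <= i < b) X i i.+1 - X a b)
    (c * young_const th * (w b - w a) `^ th).
Proof.
move=> th1 c0 B0 BD Ble wmono X0 dX a b.
have K0 := young_const_ge0 th1.
have [n] := ubnP (b - a); elim: n a b => // n IH a b bn ab bN.
have cK0 u : 0 <= c * young_const th * u `^ th.
  exact: mulr_ge0 (mulr_ge0 c0 K0) (powR_ge0 _ _).
have [eab|nab] := eqVneq a b.
  by subst b; rewrite big_geq// X0 subr0; apply: Ble B0 _.
have {nab}ltab : (a < b)%N by rewrite ltn_neqAle nab.
set om := w b - w a.
have om0 : 0 <= om by rewrite subr_ge0 wmono.
pose P j := [&& (a <= j)%N, (j < b)%N & w j - w a <= om / 2].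
have exP : exists j, P j.
  by exists a; rewrite /P leqnn ltab subrr divr_ge0.
have ubP j : P j -> (j <= b)%N by move=> /and3P[_ /ltnW].
have [j /and3P[aj jb wj] jmax] := ex_maxnP exP ubP.
have wj' : w b - w j.+1 <= om / 2.
  have [ejb|njb] := eqVneq j.+1 b; first by rewrite ejb subrr divr_ge0.
  have jb' : (j.+1 < b)%N by rewrite ltn_neqAle njb.
  have : ~~ P j.+1 by apply/negP => /jmax; rewrite ltnn.
  rewrite /P jb' (leqW aj)/= -ltNge /om; lra.
have jN : (j < N)%N by apply: leq_trans bN.
have half u : 0 <= u -> u <= om / 2 -> u `^ th <= 2 `^ (- th) * om `^ th.
  move=> u0 u2; apply: (@le_trans _ _ ((om / 2) `^ th)).
    by apply: ge0_ler_powR => //; rewrite ?nnegrE ?divr_ge0//; lra.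
  by rewrite powRM ?invr_ge0// -powR_inv1// -powRrM mulN1r mulrC.
have H1 := IH a j _ aj (ltnW jN).
have {H1}H1 := H1 (leq_trans (ltn_sub2r ltab jb) bn).
have H2 := IH j.+1 b _ jb bN.
have {}H2 := H2 (leq_trans (ltn_sub2l ltab (leq_ltn_trans aj (ltnSn j))) bn).
have H3 := dX a j j.+1 aj (leqnSn j) jN.
have H4 := dX a j.+1 b (leqW aj) jb bN.
(* The cell from [j] to [j.+1], where the control passes one half, is kept whole. Besides the two
   recursive terms there remain two defects: at [j] between [a] and [j.+1], and at [j.+1] between
   [a] and [b]. *)
have -> : \sum_(a <= i < b) X i i.+1 - X a b =
  (\sum_(a <= i < j) X i i.+1 - X a j) +
  (\sum_(j.+1 <= i < b) X i i.+1 - X j.+1 b) +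
  (X a j + X j j.+1 - X a j.+1) + (X a j.+1 + X j.+1 b - X a b).
  rewrite (big_cat_nat (n := j)) ?(ltnW jb)//= [X in _ + X - _](big_ltn jb).
  set S1 := \sum_(_ <= _ < _) _; set S2 := \sum_(_ <= _ < _) _.
  rewrite !addrA [RHS](ACl (1*6*3*10*(2*5)*(4*9)*(7*8)))/=.
  by rewrite !addNr !addr0.
apply: Ble (BD _ _ _ _ (BD _ _ _ _ (BD _ _ _ _ H1 H2) H3) H4) _.
have q1 : (w j - w a) `^ th <= 2 `^ (- th) * om `^ th.
  by apply: half => //; rewrite subr_ge0 wmono// ltnW.
have q2 : (w b - w j.+1) `^ th <= 2 `^ (- th) * om `^ th.
  by apply: half => //; rewrite subr_ge0 wmono.
have q3 : (w j.+1 - w a) `^ th <= om `^ th.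
  have w1 : w a <= w j.+1 by rewrite wmono// leqW.
  have w2 : w j.+1 <= w b by rewrite wmono.
  by apply: ge0_ler_powR; rewrite ?nnegrE /om; lra.
(* [young_const th] solves K = 2 + 2 K 2^(-th): two defects, and two recursive terms with at most
   half the control. *)
have e : young_const th * (1 - 2 * 2 `^ (- th)) = 2.
  have -> : 2 * 2 `^ (- th) = 2 `^ (1 - th) :> R.
    by rewrite powRD ?powRr1//; apply/implyP => /eqP; lra.
  rewrite /young_const mulfVK// subr_eq0 gt_eqF//.
  by rewrite powR2_lt1// subr_lt0.
rewrite -/om in q1 q2 q3 *.
have p0 : 0 <= om `^ th by rewrite powR_ge0.
have e' : young_const th = 2 + 2 * young_const th * 2 `^ (- th) by lra.
move: (young_const th) K0 e' cK0 H1 H2 => K K0 e' cK0 _ _.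
have r1 := ler_wpM2l (mulr_ge0 c0 K0) q1.
have r2 := ler_wpM2l (mulr_ge0 c0 K0) q2.
have r3 := ler_wpM2l c0 q3.
rewrite {3}e'; lra.
Qed.

(** * Calculus modulo remainders that vanish in Riemann sums *)

Section differential_calculus.
Variables (R : realType) (V : R -> R) (th : R).
Hypothesis th1 : 1 < th.
Hypothesis Vmono : forall s t, 0 <= s -> s <= t -> t <= 1 -> V s <= V t.

Definition kappa (s t : R) : R := (V t - V s) `^ th.

(** The factor [e] carries the smallness. As [V] is not assumed continuous, sums of [kappa] over
    fine subdivisions are bounded but need not tend to 0. *)
Definition infinitesimal (r : R -> R -> R) : Prop :=
  forall e, 0 < e -> exists2 d, 0 < d &
    forall s t, 0 <= s -> s <= t -> t <= 1 -> t - s < d ->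
      `|r s t| <= e * kappa s t.

(** The two increments may lie over different subintervals of [[a, b]]: the defect of a Young sum
    pairs [[s, r]] with [[r, t]], and a tagged sum pairs the part of a cell before its tag with the
    whole cell. *)
Definition compatible (f g : R -> R) : Prop :=
  forall e, 0 < e -> exists2 d, 0 < d &
    forall a b s t s' t', 0 <= a -> b <= 1 -> b - a < d ->
      a <= s -> s <= t -> t <= b -> a <= s' -> s' <= t' -> t' <= b ->
      `|f t - f s| * `|g t' - g s'| <= e * kappa a b.

Definition bounded01 (f : R -> R) : Prop :=
  exists2 C, 0 < C & forall t, 0 <= t -> t <= 1 -> `|f t| <= C.

(* d G = f d g, up to a remainder which does not contribute to sums over
   fine subdivisions. *)
Definition differential (G f g : R -> R) : Prop :=
  infinitesimal (fun s t => G t - G s - f s * (g t - g s)).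

Lemma kappa_ge0 s t : 0 <= kappa s t.
Proof. exact: powR_ge0. Qed.

Lemma kappa_mono a b s t :
  0 <= a -> a <= s -> s <= t -> t <= b -> b <= 1 -> kappa s t <= kappa a b.
Proof.
move=> a0 as_ st tb b1; have th0 : 0 <= th by move: th1; lra.
have s0 : 0 <= s by lra.
have t1 : t <= 1 by lra.
have as1 : s <= 1 by lra.
have t0 : 0 <= t by lra.
have := Vmono s0 st t1; have := Vmono a0 as_ as1; have := Vmono t0 tb b1.
move=> h1 h2 h3; rewrite /kappa; apply: ge0_ler_powR; rewrite ?nnegrE. all: lra.
Qed.

(** In each term one factor [V (u i.+1) - V (u i)] telescopes, and the remaining power [th - 1 > 0]
    is bounded by that of the total increment. *)
Lemma sum_kappa_le (N : nat) (u : nat -> R) :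
  0 <= u 0%N -> (forall i, (i < N)%N -> u i <= u i.+1) -> u N <= 1 ->
  \sum_(0 <= i < N) kappa (u i) (u i.+1) <= kappa 0 1.
Proof.
move=> u0 um uN.
have um' i j : (i <= j)%N -> (j <= N)%N -> u i <= u j.
  elim: j => [|j IH]; first by rewrite leqn0 => /eqP ->.
  rewrite leq_eqVlt => /predU1P[->//|ij] jN.
  by apply: le_trans (um _ jN); apply: IH => //; exact: ltnW.
have ub i : (i <= N)%N -> 0 <= u i /\ u i <= 1.
  by move=> iN; split; [apply: le_trans u0 _|apply: le_trans _ uN]; exact: um'.
set om := V 1 - V 0.
have om0 : 0 <= om by rewrite subr_ge0 Vmono ?ler01.
have kE t : 0 <= t -> t `^ th = t * t `^ (th - 1).
  by move=> t0; rewrite mulr_powRB1//; move: th1; lra.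
apply: (@le_trans _ _ (\sum_(0 <= i < N) (V (u i.+1) - V (u i)) * om `^ (th - 1))).
  rewrite big_nat_cond [leRHS]big_nat_cond; apply: ler_sum => i.
  rewrite andbT => /andP[_ iN].
  have [a0 a1] := ub _ (ltnW iN); have [b0 b1] := ub _ iN.
  have h := Vmono a0 (um _ iN) b1.
  rewrite /kappa kE ?subr_ge0//; apply: ler_wpM2l; first by rewrite subr_ge0.
  have h1 := Vmono (lexx 0) a0 a1; have h2 := Vmono b0 b1 (lexx 1).
  by apply: ge0_ler_powR; rewrite ?nnegrE /om; move: th1; lra.
rewrite -mulr_suml telescope_sumr//= /kappa -/om kE//.
apply: ler_wpM2r; first exact: powR_ge0.
have [a0 a1] := ub _ (leq0n N); have [b0 b1] := ub _ (leqnn N).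
have h1 := Vmono (lexx 0) a0 a1; have h2 := Vmono b0 b1 (lexx 1).
rewrite /om; lra.
Qed.

Lemma infinitesimal_sum (r : R -> R -> R) : infinitesimal r ->
  forall e, 0 < e -> exists2 d, 0 < d & forall (N : nat) (u : nat -> R),
    0 <= u 0%N -> (forall i, (i < N)%N -> u i <= u i.+1) -> u N <= 1 ->
    (forall i, (i < N)%N -> u i.+1 - u i < d) ->
    \sum_(0 <= i < N) `|r (u i) (u i.+1)| <= e.
Proof.
(* The [+ 1] keeps the denominator positive when [kappa 0 1 = 0]; the same device recurs below. *)
move=> nr e e0; pose e' := e / (kappa 0 1 + 1).
have k0 := kappa_ge0 0 1.
have e'0 : 0 < e' by rewrite divr_gt0//; lra.
have [d d0 dr] := nr _ e'0; exists d => // N u u0 um uN ud.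
have um' i j : (i <= j)%N -> (j <= N)%N -> u i <= u j.
  elim: j => [|j IH]; first by rewrite leqn0 => /eqP ->.
  rewrite leq_eqVlt => /predU1P[->//|ij] jN.
  by apply: le_trans (um _ jN); apply: IH => //; exact: ltnW.
apply: (@le_trans _ _ (\sum_(0 <= i < N) e' * kappa (u i) (u i.+1))).
  rewrite big_nat_cond [leRHS]big_nat_cond; apply: ler_sum => i.
  rewrite andbT => /andP[_ iN]; apply: dr.
  - by apply: le_trans u0 _; apply: um' => //; exact: ltnW.
  - exact: um.
  - by apply: le_trans uN; exact: um'.
  - exact: ud.
rewrite -mulr_sumr; have := ler_wpM2l (ltW e'0) (sum_kappa_le u0 um uN).
move=> /le_trans; apply; rewrite /e' mulrAC ler_pdivrMr; last lra.
by rewrite mulrDr; lra.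
Qed.

Lemma infinitesimal_ler r r' C : 0 < C -> infinitesimal r ->
  (forall s t, 0 <= s -> s <= t -> t <= 1 -> `|r' s t| <= C * `|r s t|) ->
  infinitesimal r'.
Proof.
move=> C0 nr rr' e e0; have [d d0 dr] := nr _ (divr_gt0 e0 C0).
exists d => // s t s0 st t1 std; apply: le_trans (rr' _ _ s0 st t1) _.
have := ler_wpM2l (ltW C0) (dr _ _ s0 st t1 std).
by move=> /le_trans; apply; rewrite mulrA [C * _]mulrC divfK// gt_eqF.
Qed.

Lemma eq_infinitesimal r r' :
  (forall s t, 0 <= s -> s <= t -> t <= 1 -> r' s t = r s t) ->
  infinitesimal r -> infinitesimal r'.
Proof.
move=> rr' nr; apply: (infinitesimal_ler ltr01 nr) => s t s0 st t1.
by rewrite mul1r rr'.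
Qed.

Lemma infinitesimal0 : infinitesimal (fun _ _ => 0).
Proof.
move=> e e0; exists 1 => // s t *.
by rewrite normr0 mulr_ge0// ?kappa_ge0// ltW.
Qed.

Lemma infinitesimalD r r' : infinitesimal r -> infinitesimal r' ->
  infinitesimal (fun s t => r s t + r' s t).
Proof.
move=> nr nr' e e0; have e2 : 0 < e / 2 by rewrite divr_gt0.
have [d d0 dr] := nr _ e2; have [d' d'0 dr'] := nr' _ e2.
exists (Num.min d d'); first by rewrite lt_min d0.
move=> s t s0 st t1; rewrite lt_min => /andP[/(dr _ _ s0 st t1) h].
move=> /(dr' _ _ s0 st t1) h'; apply: le_trans (ler_normD _ _) _; lra.
Qed.

Lemma infinitesimalM f r : bounded01 f -> infinitesimal r ->
  infinitesimal (fun s t => f s * r s t).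
Proof.
move=> [C C0 fC] nr; apply: (infinitesimal_ler C0 nr) => s t s0 st t1.
by rewrite normrM ler_wpM2r// fC//; lra.
Qed.

Lemma compatible_infinitesimal f g : compatible f g ->
  infinitesimal (fun s t => (f t - f s) * (g t - g s)).
Proof.
move=> fg e e0; have [d d0 dfg] := fg _ e0; exists d => // s t s0 st t1 std.
by rewrite normrM; apply: dfg => //; lra.
Qed.

Lemma compatibleC f g : compatible f g -> compatible g f.
Proof.
move=> fg e e0; have [d d0 dfg] := fg _ e0; exists d => //.
by move=> *; rewrite mulrC; apply: dfg.
Qed.

Lemma eq_compatible f f' g g' :
  (forall t, 0 <= t -> t <= 1 -> f t = f' t) ->
  (forall t, 0 <= t -> t <= 1 -> g t = g' t) ->
  compatible f' g' -> compatible f g.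
Proof.
move=> ff gg fg e e0; have [d d0 dfg] := fg _ e0; exists d => //.
move=> a b s t s' t' *; rewrite !ff ?gg; try lra.
by apply: dfg.
Qed.

Lemma bounded01M f g : bounded01 f -> bounded01 g ->
  bounded01 (fun t => f t * g t).
Proof.
move=> [C C0 fC] [D D0 gD]; exists (C * D); first exact: mulr_gt0.
by move=> t t0 t1; rewrite normrM ler_pM// ?fC ?gD.
Qed.

Lemma bounded01_cst c : bounded01 (fun=> c).
Proof. by exists (`|c| + 1) => *; rewrite ?ltr_pwDr// ler_wpDr. Qed.

Lemma bounded01X f n : bounded01 f -> bounded01 (fun t => f t ^+ n).
Proof.
move=> bf; elim: n => [|n IH]; first exact: bounded01_cst.
have [C C0 h] := bounded01M bf IH; exists C => // t t0 t1.
by rewrite exprS h.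
Qed.

Lemma compatibleM f f' g : bounded01 f -> bounded01 f' ->
  compatible f g -> compatible f' g -> compatible (fun t => f t * f' t) g.
Proof.
move=> [C C0 fC] [C' C'0 fC'] fg fg' e e0.
have [d d0 dfg] := fg _ (divr_gt0 e0 (mulr_gt0 (ltr0Sn R 1) C'0)).
have [d' d'0 dfg'] := fg' _ (divr_gt0 e0 (mulr_gt0 (ltr0Sn R 1) C0)).
exists (Num.min d d'); first by rewrite lt_min d0.
move=> a b s t s' t' a0 b1; rewrite lt_min => /andP[bd bd'] as_ st tb as' st' tb'.
have h := dfg _ _ _ _ _ _ a0 b1 bd as_ st tb as' st' tb'.
have h' := dfg' _ _ _ _ _ _ a0 b1 bd' as_ st tb as' st' tb'.
have -> : f t * f' t - f s * f' s = f' t * (f t - f s) + f s * (f' t - f' s).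
  by ring.
apply: (@le_trans _ _ ((C' * `|f t - f s| + C * `|f' t - f' s|) * `|g t' - g s'|)).
  apply: ler_wpM2r => //; apply: le_trans (ler_normD _ _) _.
  have ? : `|f' t| <= C' by apply: fC'; lra.
  have ? : `|f s| <= C by apply: fC; lra.
  by rewrite !normrM; apply: lerD; apply: ler_wpM2r.
rewrite mulrDl -!mulrA.
apply: le_trans (lerD (ler_wpM2l (ltW C'0) h) (ler_wpM2l (ltW C0) h')) _.
rewrite !mulrA le_eqVlt; apply/orP; left; apply/eqP; field.
by rewrite !gt_eqF.
Qed.

Lemma compatible_cst c g : compatible (fun=> c) g.
Proof.
move=> e e0; exists 1 => // *; rewrite subrr normr0 mul0r.
by rewrite mulr_ge0// ?kappa_ge0// ltW.
Qed.

Lemma compatibleX f g n : bounded01 f -> compatible f g ->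
  compatible (fun t => f t ^+ n) g.
Proof.
move=> bf fg; elim: n => [|n IH]; first exact: compatible_cst.
apply: eq_compatible (compatibleM bf (bounded01X n bf) fg IH) => // t _ _.
by rewrite exprS.
Qed.

(** An increment of [G] is at most [C] times that of [g], plus a remainder already small against
    [kappa]. For the remainder it suffices that increments of [h] are bounded by [2 * D]. *)
Lemma differential_compatible G f g h : bounded01 f -> bounded01 h ->
  compatible g h -> differential G f g -> compatible G h.
Proof.
move=> [C C0 fC] [D D0 hD] gh Gfg e e0.
have [d d0 dgh] := gh _ (divr_gt0 e0 (mulr_gt0 (ltr0Sn R 1) C0)).
have [d' d'0 dG] := Gfg _ (divr_gt0 e0 (mulr_gt0 (ltr0Sn R 3) D0)).
exists (Num.min d d'); first by rewrite lt_min d0.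
move=> a b s t s' t' a0 b1; rewrite lt_min => /andP[bd bd'] as_ st tb as' st' tb'.
have H1 := dgh _ _ _ _ _ _ a0 b1 bd as_ st tb as' st' tb'.
have s0 : 0 <= s by lra.
have t1 : t <= 1 by lra.
have ts : t - s < d' by lra.
have H2 := dG s t s0 st t1 ts.
have H3 : `|h t' - h s'| <= 2 * D.
  apply: le_trans (ler_normB _ _) _.
  have : `|h t'| <= D by apply: hD; lra.
  have : `|h s'| <= D by apply: hD; lra.
  lra.
have H4 : `|f s| <= C by apply: fC; lra.
have H5 : `|G t - G s| <= C * `|g t - g s| + e / (4 * D) * kappa a b.
  rewrite -[G t - G s](subrK (f s * (g t - g s))).
  apply: le_trans (ler_normD _ _) _; rewrite addrC; apply: lerD.
    by rewrite normrM ler_wpM2r.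
  apply: le_trans H2 _; apply: ler_wpM2l; last exact: kappa_mono.
  by rewrite divr_ge0// ?mulr_ge0// ltW.
apply: le_trans (ler_wpM2r (normr_ge0 _) H5) _; rewrite mulrDl -(mulrA C).
have K0 : 0 <= e / (4 * D) * kappa a b.
  by rewrite mulr_ge0 ?kappa_ge0// divr_ge0// ?mulr_ge0// ltW.
apply: le_trans (lerD (ler_wpM2l (ltW C0) H1) (ler_wpM2l K0 H3)) _.
rewrite !mulrA le_eqVlt; apply/orP; left; apply/eqP; field.
by rewrite !gt_eqF.
Qed.

(** The relation bounds increments of [G] only over intervals shorter than [d], so [[0, t]] is
    crossed in [N] such steps, with [N] independent of [t]. *)
Lemma differential_bounded G f g : bounded01 f -> bounded01 g ->
  differential G f g -> bounded01 G.
Proof.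
move=> [C C0 fC] [D D0 gD] Gfg; have [d d0 dG] := Gfg _ ltr01.
set M := C * (2 * D) + kappa 0 1.
have M0 : 0 < M by rewrite ltr_pwDl ?kappa_ge0// !mulr_gt0.
pose N := (Num.truncn (d^-1)).+1.
have Nd : N%:R^-1 < d.
  by rewrite invf_plt ?posrE ?ltr0n// truncnS_gt.
have N0 : 0 < N%:R :> R by rewrite ltr0n.
exists (N%:R * M + `|G 0| + 1).
  by rewrite ltr_wpDl// addr_ge0// mulr_ge0// ltW.
move=> t t0 t1; pose u (i : nat) := Num.min (i%:R / N%:R) t.
have u01 i : 0 <= u i /\ u i <= 1.
  by split; rewrite /u ?le_min ?ge_min ?t0 ?t1 ?andbT ?orbT// divr_ge0.
have um i : u i <= u i.+1.
  rewrite /u le_min !ge_min lexx orbT andbT ler_wpM2r ?invr_ge0//.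
  by rewrite ler_nat.
have ud i : u i.+1 - u i < d.
  apply: le_lt_trans Nd; rewrite /u -(natr1 i) mulrDl mul1r.
  have : 0 <= (N%:R^-1 : R) by rewrite invr_ge0 ltW.
  by rewrite /Order.min; case: ltP => ?; case: ltP => ?; lra.
have uN : u N = t by rewrite /u divff ?gt_eqF//; apply/min_idPr.
have u0 : u 0%N = 0 by rewrite /u mul0r; apply/min_idPl.
have -> : G t = \sum_(0 <= i < N) (G (u i.+1) - G (u i)) + G 0.
  by rewrite (telescope_sumr (fun i => G (u i)))// uN u0 subrK.
apply: le_trans (ler_normD _ _) _.
suff : `|\sum_(0 <= i < N) (G (u i.+1) - G (u i))| <= N%:R * M by lra.
apply: le_trans (ler_norm_sum _ _ _) _.
rewrite mulr_natl -[in leRHS](subn0 N) -sumr_const_nat; apply: ler_sum => i _.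
have [a0 a1] := u01 i; have [b0 b1] := u01 i.+1.
rewrite -[G _ - G _](subrK (f (u i) * (g (u i.+1) - g (u i)))).
apply: le_trans (ler_normD _ _) _; rewrite addrC; apply: lerD.
  rewrite normrM ler_pM// ?fC//; apply: le_trans (ler_normB _ _) _.
  by have := gD _ a0 a1; have := gD _ b0 b1; lra.
apply: le_trans (dG _ _ a0 (um i) b1 (ud i)) _.
by rewrite mul1r; apply: kappa_mono.
Qed.

Lemma differential_id g : differential g (fun=> 1) g.
Proof.
by apply: eq_infinitesimal infinitesimal0 => s t *; rewrite mul1r subrr.
Qed.

Lemma differential_cst c g : differential (fun=> c) (fun=> 0) g.
Proof.
by apply: eq_infinitesimal infinitesimal0 => s t *; rewrite mul0r subrr subr0.
Qed.

Lemma eq_differential G G' f f' g :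
  (forall t, 0 <= t -> t <= 1 -> G t = G' t) ->
  (forall t, 0 <= t -> t <= 1 -> f t = f' t) ->
  differential G' f' g -> differential G f g.
Proof.
move=> GG ff; apply: eq_infinitesimal => s t *.
by rewrite !GG ?ff//; lra.
Qed.

Lemma differentialD G G' f f' g : differential G f g -> differential G' f' g ->
  differential (fun t => G t + G' t) (fun t => f t + f' t) g.
Proof.
move=> h h'; apply: eq_infinitesimal (infinitesimalD h h') => s t *; ring.
Qed.

Lemma differentialZ c G f g : differential G f g ->
  differential (fun t => c * G t) (fun t => c * f t) g.
Proof.
move=> h; apply: eq_infinitesimal (infinitesimalM (bounded01_cst c) h) => s t *; ring.
Qed.

Lemma differential_sum (m : nat) (G f : nat -> R -> R) g :
  (forall i, (i < m)%N -> differential (G i) (f i) g) ->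
  differential (fun t => \sum_(0 <= i < m) G i t)
    (fun t => \sum_(0 <= i < m) f i t) g.
Proof.
elim: m => [|m IH] h.
  apply: eq_differential (differential_cst 0 g) => t *; by rewrite big_nil.
have := differentialD (IH (fun i im => h i (ltnW im))) (h m (ltnSn m)).
by apply: eq_differential => t *; rewrite big_nat_recr.
Qed.

(** The product rule leaves the term (G t - G s)(G' t - G' s). It is infinitesimal because
    [compatible g g] passes from [g] to [G] in one argument and then from [g] to [G'] in the
    other. *)
Lemma differentialM G G' f f' g :
  bounded01 g -> compatible g g ->
  bounded01 G -> bounded01 G' -> bounded01 f -> bounded01 f' ->
  differential G f g -> differential G' f' g ->
  differential (fun t => G t * G' t) (fun t => f t * G' t + G t * f' t) g.
Proof.
move=> bg gg bG bG' bf bf' h h'.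
have c1 := compatibleC (differential_compatible bf bg gg h).
have c2 := compatibleC (differential_compatible bf' bG c1 h').
have n1 := infinitesimalD (infinitesimalM bG' h) (infinitesimalM bG h').
have := infinitesimalD n1 (compatible_infinitesimal c2).
by apply: eq_infinitesimal => s t *; ring.
Qed.

Lemma differentialX g n : bounded01 g -> compatible g g ->
  differential (fun t => g t ^+ n) (fun t => n%:R * g t ^+ n.-1) g.
Proof.
move=> bg gg; elim: n => [|n IH].
  by apply: eq_differential (differential_cst 1 g) => t *; rewrite ?mul0r.
have bf : bounded01 (fun t => n%:R * g t ^+ n.-1).
  by apply: bounded01M; [exact: bounded01_cst|exact: bounded01X].
have := differentialM bg gg bg (bounded01X n bg) (bounded01_cst 1) bf
  (differential_id g) IH.
apply: eq_differential => t _ _; first by rewrite exprS.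
case: n {IH bf} => [|n] /=; first by rewrite !expr0; ring.
by rewrite -[n.+2]addn1 natrD exprS; ring.
Qed.

End differential_calculus.

(** * Dyadic subdivisions *)

Definition dyadic {R : realType} (m i : nat) : R := i%:R / 2 ^+ m.

Section dyadic_subdivisions.
Variable R : realType.

Lemma dyadic0 m : dyadic m 0 = 0 :> R.
Proof. by rewrite /dyadic mul0r. Qed.

Lemma dyadic1 m : dyadic m (2 ^ m) = 1 :> R.
Proof. by rewrite /dyadic natrX divff// gt_eqF// exprn_gt0. Qed.

Lemma dyadic_le m i j : (i <= j)%N -> dyadic m i <= dyadic m j :> R.
Proof. by move=> ij; rewrite ler_wpM2r ?ler_nat// invr_ge0 exprn_ge0. Qed.

Lemma dyadic_ge0 m i : 0 <= dyadic m i :> R.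
Proof. by rewrite -(dyadic0 m) dyadic_le. Qed.

Lemma dyadic_le1 m i : (i <= 2 ^ m)%N -> dyadic m i <= 1 :> R.
Proof. by move=> im; rewrite -(dyadic1 m) dyadic_le. Qed.

Lemma dyadic_step m i : dyadic m i.+1 - dyadic m i = 1 / 2 ^+ m :> R.
Proof. by rewrite /dyadic -natr1 mulrDl addrAC subrr add0r. Qed.

Lemma dyadic_refine m q i : dyadic (m + q) (i * 2 ^ q) = dyadic m i :> R.
Proof.
rewrite /dyadic natrM natrX exprD invfM [(2 ^+ m)^-1 * _]mulrC mulrA mulfK//.
Qed.

Lemma dyadic_small (d : R) : 0 < d ->
  exists m0, forall m, (m0 <= m)%N -> 1 / 2 ^+ m < d.
Proof.
move=> d0; have [m0 _ h] := near_infty_natSinv_expn_lt (PosNum d0).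
by exists m0.
Qed.

End dyadic_subdivisions.

(** * Refinement of subdivisions and construction of Young primitives *)

Section sewing.
Variables (R : realType) (V : R -> R) (th : R).
Hypothesis th1 : 1 < th.
Hypothesis Vmono : forall s t, 0 <= s -> s <= t -> t <= 1 -> V s <= V t.

Local Notation kappa := (kappa V th).

(** [sewing_bound] is applied inside each of the [M] coarse cells, and the values of [kappa] on
    these cells add up to at most [kappa 0 1]. It is used with real values for Young sums and with
    functions on the plane for staircases. *)
Lemma sewing_refine (W : zmodType) (B : W -> R -> Prop) (X : R -> R -> W)
    (c d : R) (M q : nat) (u : nat -> R) :
  0 <= c ->
  B 0 0 ->
  (forall v v' r r', B v r -> B v' r' -> B (v + v') (r + r')) ->
  (forall v r r', B v r -> r <= r' -> B v r') ->
  (forall s, X s s = 0) ->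
  (forall s r t, 0 <= s -> s <= r -> r <= t -> t <= 1 -> t - s < d ->
    B (X s r + X r t - X s t) (c * kappa s t)) ->
  (forall i j, (i <= j)%N -> u i <= u j) -> 0 <= u 0%N -> u (M * q)%N <= 1 ->
  (forall i, (i < M)%N -> u (i.+1 * q)%N - u (i * q)%N < d) ->
  B (\sum_(0 <= l < M * q) X (u l) (u l.+1) -
     \sum_(0 <= i < M) X (u (i * q)%N) (u (i.+1 * q)%N))
    (c * young_const th * kappa 0 1).
Proof.
move=> c0 B0 BD Ble X0 dX um u0 uM ud.
rewrite big_nat_mul -sumrB.
have K0 := young_const_ge0 th1.
have := @sum_kappa_le _ V _ th1 Vmono M (fun i => u (i * q)%N).
rewrite mul0n => /(_ u0 (fun i _ => um _ _ (leq_mul (leqnSn i) (leqnn q))) uM).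
(* The bound is replaced by the sum of the bounds on the cells, so that the claim can be proved cell
   by cell. *)
move=> /(ler_wpM2l (mulr_ge0 c0 K0)) h0; refine (Ble _ _ _ _ h0); clear h0.
rewrite mulr_sumr big_nat_cond [X in B _ X]big_nat_cond.
apply: (big_ind2 B) => [//|v r v' r'|i]; first exact: BD.
rewrite andbT => /andP[_ iM].
have iq : (i * q <= i.+1 * q)%N by rewrite leq_mul.
have iMq : (i.+1 * q <= M * q)%N by rewrite leq_mul.
have u01 j : (j <= q)%N -> 0 <= u (j + i * q)%N /\ u (j + i * q)%N <= 1.
  move=> jq; split; first by apply: le_trans u0 _; exact: um.
  apply: le_trans uM; apply: um; apply: leq_trans iMq.
  by rewrite mulSn leq_add2r.
have := @sewing_bound _ th W B (fun l => V (u (l + i * q)%N))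
  (fun j k => X (u (j + i * q)%N) (u (k + i * q)%N)) c q th1 c0 B0 BD Ble.
rewrite -[X in \sum_(X <= _ < _) _](add0n (i * q)%N) big_addn mulSn addnK.
have -> : \sum_(0 <= j < q) X (u (j + i * q)%N) (u (j + i * q).+1) =
          \sum_(0 <= j < q) X (u (j + i * q)%N) (u (j.+1 + i * q)%N) by [].
move=> h; have := h _ _ _ 0%N q (leq0n _) (leqnn _); apply.
- move=> j k jk kq; apply: Vmono.
  + by have [] := u01 j (leq_trans jk kq).
  + by apply: um; rewrite leq_add2r.
  + by have [] := u01 k kq.
- by move=> j.
- move=> j k l jk kl lq; apply: dX.
  + by have [] := u01 j (leq_trans jk (leq_trans kl lq)).
  + by apply: um; rewrite leq_add2r.
  + by apply: um; rewrite leq_add2r.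
  + by have [] := u01 l lq.
  + apply: le_lt_trans (ud _ iM); apply: lerB; apply: um.
      by rewrite mulSn leq_add2r.
    by rewrite leq_addl.
Qed.

Section scalar_sewing.
Variables f g : R -> R.
Hypothesis bf : bounded01 f.
Hypothesis bg : bounded01 g.
Hypothesis fg : compatible V th f g.

Definition young_germ (s t : R) : R := f s * (g t - g s).

(* Riemann sums along the dyadic subdivision stopped at [t]. *)
Definition young_sum (m : nat) (t : R) : R :=
  \sum_(0 <= i < 2 ^ m)
    young_germ (Num.min (dyadic m i) t) (Num.min (dyadic m i.+1) t).

Lemma young_germ_delta s r t :
  young_germ s r + young_germ r t - young_germ s t = (f r - f s) * (g t - g r).
Proof. by rewrite /young_germ; ring. Qed.

Lemma young_sum_cauchy e : 0 < e ->
  exists m0, forall m m' t, (m0 <= m)%N -> (m <= m')%N -> 0 <= t -> t <= 1 ->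
    `|young_sum m' t - young_sum m t| <= e.
Proof.
move=> e0; have K0 := young_const_ge0 th1; have k0 := kappa_ge0 V th 0 1.
have C0 : 0 < young_const th * kappa 0 1 + 1 by rewrite ltr_wpDl// mulr_ge0.
have [d d0 dfg] := fg (divr_gt0 e0 C0).
have [m0 m0d] := dyadic_small d0; exists m0 => m m' t m0m mm' t0 t1.
have -> : m' = (m + (m' - m))%N by rewrite subnKC.
set q := (m' - m)%N; pose u l := Num.min (dyadic (m + q) l) t.
have c0 : 0 <= e / (young_const th * kappa 0 1 + 1) by rewrite ltW ?divr_gt0.
have uq i : u (i * 2 ^ q)%N = Num.min (dyadic m i) t by rewrite /u dyadic_refine.
have := @sewing_refine R (fun v r => `|v| <= r) young_germ _ d (2 ^ m) (2 ^ q) u c0.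
rewrite -expnD; under [X in _ - X]eq_bigr do rewrite !uq.
move=> h; apply: le_trans (h _ _ _ _ _ _ _ _ _) _.
- by rewrite normr0.
- by move=> v v' r r' vr vr'; apply: le_trans (ler_normD _ _) _; exact: lerD.
- by move=> v r r'; exact: le_trans.
- by move=> s; rewrite /young_germ subrr mulr0.
- move=> s r w s0 sr rw w1 wsd; rewrite young_germ_delta normrM.
  by apply: dfg => //; exact: le_trans rw.
- by move=> i j ij; rewrite /u le_min !ge_min lexx orbT andbT dyadic_le.
- by rewrite /u le_min dyadic_ge0.
- by rewrite /u ge_min t1 orbT.
- move=> i im; rewrite !uq; apply: le_lt_trans (m0d _ m0m).
  rewrite -(dyadic_step _ m i); have := @dyadic_le R m _ _ (leqnSn i).
  by rewrite /Order.min; case: ltP => ?; case: ltP => ?; lra.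
- by rewrite -mulrA mulrAC ler_pdivrMr// ler_wpM2l ?ltW ?ltrDl.
Qed.

Definition young_primitive (t : R) : R := lim (young_sum m t @[m --> \oo]).

Lemma young_primitive_approx e : 0 < e ->
  exists m0, forall m t, (m0 <= m)%N -> 0 <= t -> t <= 1 ->
    `|young_primitive t - young_sum m t| <= e.
Proof.
move=> e0; have [m0 h] := young_sum_cauchy e0.
exists m0 => m t m0m t0 t1.
have cv : cvg (young_sum m t @[m --> \oo]).
  apply/cauchy_cvgP/cauchy_exP => r r0.
  have r2 : 0 < r / 2 by rewrite divr_gt0.
  have [m1 h1] := young_sum_cauchy r2.
  exists (young_sum m1 t); exists m1 => // m' /= m1m'.
  rewrite /ball/= distrC; apply: le_lt_trans (h1 _ _ _ (leqnn _) m1m' t0 t1) _.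
  lra.
have /cvgrPdist_le cv' : young_sum m t @[m --> \oo] --> young_primitive t by [].
apply/ler_addgt0Pr => r r0; have [m1 _ h1] := cv' _ r0.
have {}h1 := h1 (maxn m m1) (leq_maxr _ _).
have {}h := h m (maxn m m1) t m0m (leq_maxl _ _) t0 t1.
rewrite -[_ - young_sum m t](subrKA (young_sum (maxn m m1) t)).
by apply: le_trans (ler_normD _ _) _; rewrite addrC; apply: lerD.
Qed.

(** Clamping the dyadic points to [[s, t]] gives a subdivision of [[s, t]] with repetitions, on
    which the germ vanishes. Sewing compares it with the single step from [s] to [t], for all orders
    [m] at once. *)
Lemma young_sum_local e : 0 < e -> exists2 d, 0 < d &
  forall m s t, 0 <= s -> s <= t -> t <= 1 -> t - s < d ->
  `|\sum_(0 <= i < 2 ^ m)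
     young_germ (Num.max s (Num.min (dyadic m i) t))
       (Num.max s (Num.min (dyadic m i.+1) t)) - young_germ s t|
    <= e * kappa s t.
Proof.
move=> e0; have K0 := young_const_ge0 th1.
have C0 : 0 < young_const th + 1 by rewrite ltr_wpDl.
have [d d0 dfg] := fg (divr_gt0 e0 C0); exists d => // m s t s0 st t1 std.
pose u l := Num.max s (Num.min (dyadic m l) t).
have c0 : 0 <= e / (young_const th + 1) by rewrite ltW ?divr_gt0.
have us i : s <= u i by rewrite /u le_max lexx.
have ut i : u i <= t by rewrite /u ge_max st ge_min lexx orbT.
have um i j : (i <= j)%N -> u i <= u j.
  move=> ij; rewrite /u ge_max !le_max lexx/= le_min !ge_min lexx !orbT andbT.
  by rewrite dyadic_le ?orbT.
have uE0 : u 0%N = s.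
  rewrite /u dyadic0; apply/max_idPl.
  by rewrite ge_min s0.
have uE1 : u (2 ^ m)%N = t.
  by rewrite /u dyadic1 min_r// max_r.
have := @sewing_bound _ th R (fun v r => `|v| <= r) (fun l => V (u l))
  (fun i j => young_germ (u i) (u j)) _ (2 ^ m) th1 c0.
move=> h; have {}h := h _ _ _ _ _ _ 0%N (2 ^ m)%N (leq0n _) (leqnn _).
rewrite uE0 uE1 in h; apply: le_trans (h _ _ _ _ _ _) _.
- by rewrite normr0.
- by move=> v v' r r' vr vr'; apply: le_trans (ler_normD _ _) _; exact: lerD.
- by move=> v r r'; exact: le_trans.
- move=> i j ij _; apply: Vmono => //; first exact: le_trans s0 _.
    exact: um.
  exact: le_trans (ut _) t1.
- by move=> i; rewrite /young_germ subrr mulr0.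
- move=> i j k ij jk km; rewrite young_germ_delta normrM.
  have := um _ _ ij; have := um _ _ jk; have := us i; have := ut k.
  by move=> *; apply: dfg => //; lra.
- rewrite -/(kappa s t) ler_wpM2r ?kappa_ge0//.
  by rewrite mulrAC ler_pdivrMr// ler_wpM2l ?ltW ?ltrDl.
Qed.

(** Additivity over intervals fails only in a cell with [s] in its interior, where the discrepancy
    is one defect of the germ; in all other cells the difference is 0. *)
Lemma young_sum_split e : 0 < e -> exists m0, forall m s t,
  (m0 <= m)%N -> 0 <= s -> s <= t -> t <= 1 ->
  `|young_sum m t - young_sum m s - \sum_(0 <= i < 2 ^ m)
     young_germ (Num.max s (Num.min (dyadic m i) t))
       (Num.max s (Num.min (dyadic m i.+1) t))| <= e.
Proof.
move=> e0; have k0 := kappa_ge0 V th 0 1.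
have C0 : 0 < kappa 0 1 + 1 by rewrite ltr_wpDl.
have [d d0 dfg] := fg (divr_gt0 e0 C0).
have c0 : 0 <= e / (kappa 0 1 + 1) by rewrite ltW ?divr_gt0.
have [m0 m0d] := dyadic_small d0; exists m0 => m s t m0m s0 st t1.
rewrite /young_sum -!sumrB.
apply: le_trans (ler_norm_sum _ _ _) _.
apply: (@le_trans _ _ (\sum_(0 <= i < 2 ^ m)
    e / (kappa 0 1 + 1) * kappa (dyadic m i) (dyadic m i.+1))).
  rewrite big_nat_cond [leRHS]big_nat_cond; apply: ler_sum => i.
  rewrite andbT => /andP[_ im].
  have := m0d _ m0m; rewrite -(dyadic_step _ m i).
  have := @dyadic_le R m _ _ (leqnSn i); have := dyadic_le1 R im.
  have := dyadic_ge0 R m i.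
  move: (dyadic m i) (dyadic m i.+1) => p q p0 q1 pq qpd.
  have [qs|] := boolP (q <= s); last rewrite -ltNge => sq.
    have ps : p <= s := le_trans pq qs.
    rewrite !(min_l (le_trans qs st)) !(min_l (le_trans ps st)) (min_l qs) (min_l ps).
    rewrite (max_l qs) (max_l ps) /young_germ !subrr mulr0 subrr normr0.
    by rewrite mulr_ge0 ?kappa_ge0.
  have [sp|] := boolP (s <= p); last rewrite -ltNge => ps.
    rewrite (min_r sp) (min_r (ltW sq)) /young_germ subrr mulr0 subr0.
    rewrite !max_r ?le_min ?sp ?(ltW sq)//.
    by rewrite subrr normr0 mulr_ge0 ?kappa_ge0.
  rewrite (min_l (le_trans (ltW ps) st)) (min_l (ltW ps)) (min_r (ltW sq)).
  rewrite (max_l (ltW ps)).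
  have sq' : s <= Num.min q t by rewrite le_min (ltW sq).
  rewrite (max_r sq').
  have -> : young_germ p (Num.min q t) - young_germ p s
     - young_germ s (Num.min q t) = - ((f s - f p) * (g (Num.min q t) - g s)).
    by rewrite -young_germ_delta; ring.
  rewrite normrN normrM; apply: dfg => //; first exact: ltW.
    exact: ltW.
    exact: ltW.
  by rewrite ge_min lexx.
rewrite -mulr_sumr.
have /(ler_wpM2l c0) := @sum_kappa_le _ V _ th1 Vmono (2 ^ m) (dyadic m)
  (dyadic_ge0 _ _ _) (fun i _ => dyadic_le _ m (leqnSn i)) (dyadic_le1 _ (leqnn _)).
move=> /le_trans; apply.
by rewrite mulrAC ler_pdivrMr// ler_wpM2l ?ltW ?ltrDl.
Qed.

Lemma young_primitive0 : young_primitive 0 = 0.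
Proof.
apply/eqP; rewrite -normr_le0; apply/ler_addgt0Pr => e e0; rewrite add0r.
have [m h] := young_primitive_approx e0.
have := h m 0 (leqnn _) (lexx 0) ler01; rewrite [young_sum _ _]big1 ?subr0// => i _.
by rewrite !min_r ?dyadic_ge0// /young_germ subrr mulr0.
Qed.

Lemma young_primitiveP : differential V th young_primitive f g.
Proof.
move=> e e0; have [d d0 h] := young_sum_local e0.
(* [d] is fixed before the tolerance [r]. This is possible because [young_sum_local] does not
   restrict the order [m], which is chosen afterwards in terms of [r]. *)
exists d => // s t s0 st t1 std; apply/ler_addgt0Pr => r r0.
have r3 : 0 < r / 3 by rewrite divr_gt0.
have [m1 h1] := young_primitive_approx r3.
have [m2 h2] := young_sum_split r3.
have {}h1 := h1 (maxn m1 m2) _ (leq_maxl _ _).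
have {}h2 := h2 (maxn m1 m2) s t (leq_maxr _ _) s0 st t1.
have {}h := h (maxn m1 m2) s t s0 st t1 std.
have ht := h1 t (le_trans s0 st) t1; have hs := h1 s s0 (le_trans st t1).
rewrite -/(young_germ s t).
move: h h2 hs ht.
set S := \sum_(_ <= _ < _) _; rewrite !ler_norml; lra.
Qed.

End scalar_sewing.
End sewing.

(** * Young integrals *)

(** Properness makes the limit defining [young_integral] unique. Uniform subdivisions realize every
    mesh bound; for [t = 0] the empty list is the subdivision. *)
Lemma mesh_to0_proper {R : realType} (t : R) : 0 <= t ->
  ProperFilter (mesh_to0 0 t).
Proof.
move=> t0; apply: filter_from_proper; last first.
  move=> d /= d0.
  have [->|tn0] := eqVneq t 0.
    by exists ([::], fun=> 0); split.
  have {}t0 : 0 < t by rewrite lt0r tn0.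
  pose N := Num.truncn (t / d).
  pose u (i : nat) := t * i%:R / N.+1%:R.
  have us : itv_partition 0 t (mkseq (fun i => u i.+1) N.+1).
    split.
      apply/(pathP 0) => i; rewrite size_mkseq => iN.
      rewrite -[X in nth 0 (X :: _)](_ : u 0%N = 0); last by rewrite /u mulr0 mul0r.
      rewrite nth_mkseq//.
      have -> : nth 0 (u 0%N :: mkseq (fun i => u i.+1) N.+1) i = u i.
        by case: i iN => [//|i] iN /=; rewrite nth_mkseq// ltnW.
      rewrite /u ltr_pM2r ?invr_gt0 ?ltr0n// ltr_pM2l// ltr_nat//.
    by rewrite (last_nth 0) size_mkseq /= nth_mkseq// /u mulfK// gt_eqF ?ltr0n.
  have uE k : (k <= N.+1)%N -> subdiv 0 t (mkseq (fun i => u i.+1) N.+1) k = u k.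
    rewrite /subdiv; case: k => [_|k kN]; first by rewrite /u mulr0 mul0r.
    by rewrite [LHS]/= nth_mkseq.
  move: us uE (size_mkseq (fun i => u i.+1) N.+1).
  move: (mkseq _ _) => s us uE sN; exists (s, subdiv 0 t s).
  split=> //= k; rewrite sN => kN; rewrite !uE ?(ltnW kN)//.
  rewrite lexx/= /u -mulrBl -mulrBr -[k.+1%:R]natr1 addrAC subrr add0r mulr1; split.
    by rewrite ler_wpM2r ?invr_ge0// ler_wpM2l ?lerDl// ltW.
  rewrite ltr_pdivrMr ?ltr0n// mulrC -ltr_pdivrMr//.
  exact: truncnS_gt.
apply: filter_from_filter; first by exists 1 => /=.
move=> i j /= i0 j0; exists (Num.min i j); first by rewrite /= lt_min i0.
move=> P /= [Pp h]; split; split => // k kP; have [h1] := h k kP;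
  by rewrite lt_min => /andP[].
Qed.

Section young_integral.
Variables (R : realType) (V : R -> R) (th : R).
Hypothesis th1 : 1 < th.
Hypothesis Vmono : forall s t, 0 <= s -> s <= t -> t <= 1 -> V s <= V t.

(** A tagged sum differs from the telescoping sum of [G] by the remainders of d G = f d g and by the
    effect of moving the tags to the left endpoints; each part is at most [e / 2]. The copies [f']
    and [g'] allow an integrand known only on [[0, 1]] and an integrator shifted by a constant, as
    the signature involves [gamma] itself while [x] and [y] start at 0. *)
Lemma young_integral_differential (f f' g g' G : R -> R) (c t : R) :
  (forall s, 0 <= s -> s <= 1 -> f' s = f s) ->
  (forall s, 0 <= s -> s <= 1 -> g' s = g s + c) ->
  compatible V th f g -> differential V th G f g ->
  0 <= t -> t <= 1 ->
  young_integral 0 t f' g' = G t - G 0.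
Proof.
move=> ff gg fg Gfg t0 t1; have PF := mesh_to0_proper t0.
apply: cvg_lim => //; apply/cvgrPdist_le => e e0.
have k0 := kappa_ge0 V th 0 1.
have C0 : 0 < e / 2 / (kappa V th 0 1 + 1).
  by rewrite !divr_gt0// ltr_wpDl.
have [d1 d10 h1] := fg _ C0.
have e20 : 0 < e / 2 by rewrite divr_gt0.
have [d2 d20 h2] := infinitesimal_sum th1 Vmono Gfg e20.
exists (Num.min d1 d2); first by rewrite /= lt_min d10.
move=> [s xi] /= [sp mesh]; rewrite /riemann_stieltjes_sum/=.
set N := size s; pose u := subdiv 0 t s.
have uN : u N = t by rewrite /u /subdiv (itv_partition_nth_size _ sp).
have um i : (i < N)%N -> u i <= u i.+1.
  by move=> /mesh[/andP[l1 l2] _]; exact: le_trans l1 l2.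
have ud i : (i < N)%N -> u i.+1 - u i < d1 /\ u i.+1 - u i < d2.
  by move=> /mesh[_]; rewrite lt_min => /andP[].
have uge i : (i <= N)%N -> 0 <= u i by move=> iN; exact: itv_partition_nth_ge.
have ule i : (i <= N)%N -> u i <= 1.
  by move=> iN; apply: le_trans t1; exact: itv_partition_nth_le.
have -> : G t - G 0 = \sum_(0 <= i < N) (G (u i.+1) - G (u i)).
  by rewrite (telescope_sumr (fun i => G (u i)))// uN.
rewrite -sumrB.
rewrite (eq_big_nat _ _ (F2 := fun i => (G (u i.+1) - G (u i)
   - f (u i) * (g (u i.+1) - g (u i)))
   - (f (xi i) - f (u i)) * (g (u i.+1) - g (u i)))); last first.
  move=> i /= iN; have [/andP[x1 x2] _] := mesh i iN.
  have := uge _ (ltnW iN); have := uge _ iN.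
  have := ule _ (ltnW iN); have := ule _ iN.
  rewrite -/u in x1 x2 *; move=> a1 a2 a3 a4.
  rewrite ff ?(gg (u i)) ?(gg (u i.+1)) //; [ring | lra | lra].
rewrite sumrB; apply: le_trans (ler_normB _ _) _.
have H1 := h2 N u (uge _ (leq0n _)) um (ule _ (leqnn _)) (fun i iN => (ud i iN).2).
have {}H1 := le_trans (ler_norm_sum _ _ _) H1.
suff : `|\sum_(0 <= i < N) (f (xi i) - f (u i)) * (g (u i.+1) - g (u i))| <= e / 2.
  by move: H1; lra.
apply: le_trans (ler_norm_sum _ _ _) _.
apply: (@le_trans _ _ (\sum_(0 <= i < N)
    e / 2 / (kappa V th 0 1 + 1) * kappa V th (u i) (u i.+1))).
  rewrite big_nat_cond [leRHS]big_nat_cond; apply: ler_sum => i.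
  rewrite andbT => /andP[_ iN]; rewrite normrM.
  have [/andP[x1 x2] _] := mesh i iN.
  apply: h1 => //; [exact/uge/ltnW | exact: ule | exact: (ud i iN).1 | exact: um].
rewrite -mulr_sumr.
have := sum_kappa_le th1 Vmono (uge _ (leq0n _)) um (ule _ (leqnn _)).
move=> /(ler_wpM2l (ltW C0)) /le_trans; apply.
by rewrite mulrAC ler_pdivrMr ?ltr_wpDl// ler_wpM2l ?ltW ?ltrDl.
Qed.

End young_integral.

Lemma foldl_nseq (T S : Type) (f : T -> S -> T) (z : T) (n : nat) (a : S) :
  foldl f z (nseq n a) = iter n (f^~ a) z.
Proof. by elim: n z => // n IH z; rewrite iterSr /= IH. Qed.

(** * Iterated integrals of a power of the first letter followed by a power of the second *)

Section iterated_integrals.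
Variables (R : realType) (V : R -> R) (th : R).
Hypothesis th1 : 1 < th.
Hypothesis Vmono : forall s t, 0 <= s -> s <= t -> t <= 1 -> V s <= V t.
Variables (gamma : R -> R * R) (x y : R -> R).
Hypothesis xE : forall t, 0 <= t -> t <= 1 -> x t = (gamma t).1 - (gamma 0).1.
Hypothesis yE : forall t, 0 <= t -> t <= 1 -> y t = (gamma t).2 - (gamma 0).2.
Hypotheses (bx : bounded01 x) (by_ : bounded01 y).
Hypotheses (xx : compatible V th x x) (xy : compatible V th x y).
Hypothesis (yy : compatible V th y y).

Local Notation step i := (fun (F : R -> R) t =>
  young_integral 0 t F (edual i \o gamma)).

Lemma x_at0 : x 0 = 0. Proof. by rewrite xE ?subrr// ler01. Qed.

Lemma iterated_integral_x (j : nat) (t : R) : 0 <= t -> t <= 1 ->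
  iter j (step (0 : 'I_2)) (fun=> 1) t = j`!%:R^-1 * x t ^+ j.
Proof.
elim: j t => [|j IH] t t0 t1; first by rewrite /= fact0 invr1 mul1r.
rewrite iterS; pose f s := j`!%:R^-1 * x s ^+ j.
have fx : compatible V th f x.
  exact: compatibleM (bounded01_cst _) (bounded01X j bx) (compatible_cst _ _ _ _)
    (compatibleX j bx xx).
pose G s := j.+1`!%:R^-1 * x s ^+ j.+1.
have Gf : differential V th G f x.
  apply: eq_differential (differentialZ j.+1`!%:R^-1
    (differentialX th1 Vmono j.+1 bx xx)) => // s _ _.
  rewrite /f factS natrM invfM /=; field.
  by rewrite ?nat1r !pnatr_eq0 -!lt0n fact_gt0.
rewrite (@young_integral_differential _ _ _ th1 Vmono f _ x _ G (gamma 0).1) //.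
- by rewrite /G x_at0 expr0n mulr0 subr0.
- by move=> s s0 s1; rewrite xE// subrK.
Qed.

Variable n : nat.
Let f (t : R) := n.+1`!%:R^-1 * x t ^+ n.+1.
Let H i := young_primitive (fun t => f t * y t ^+ i) y.

Let bf : bounded01 f.
Proof. by apply: bounded01M (bounded01_cst _) (bounded01X _ bx). Qed.

Let bfy i : bounded01 (fun t => f t * y t ^+ i).
Proof. by apply: bounded01M bf (bounded01X _ by_). Qed.

Let fy : compatible V th f y.
Proof.
exact: compatibleM (bounded01_cst _) (bounded01X n.+1 bx) (compatible_cst _ _ _ _)
  (compatibleX n.+1 bx xy).
Qed.

Let fyy i : compatible V th (fun t => f t * y t ^+ i) y.
Proof. exact: compatibleM bf (bounded01X _ by_) fy (compatibleX _ by_ yy). Qed.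

Let dH i : differential V th (H i) (fun t => f t * y t ^+ i) y.
Proof. exact: young_primitiveP. Qed.

Let bH i : bounded01 (H i).
Proof. exact: (differential_bounded th1 Vmono (bfy i) by_ (dH i)). Qed.

(* The solution of [d G_(j+1) = G_j d y], [G_0 = f]: a binomial expansion of
   [\int_0^t f(s) (y(t) - y(s)) ^+ j / j`! dy(s)]. *)
Let G j (t : R) := \sum_(0 <= i < j.+1)
  ((-1) ^+ i / ((j - i)`!%:R * i`!%:R)) * (y t ^+ (j - i) * H i t).

(** This is (1 - 1)^(j+1) divided by (j+1)!. It removes from the differential of [G j.+1] the terms
    in which [H i] is differentiated. *)
Let sum_alternating (j : nat) :
  \sum_(0 <= i < j.+2) ((-1) ^+ i / ((j.+1 - i)`!%:R * i`!%:R)) = 0 :> R.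
Proof.
have h : (1 - 1 : R) ^+ j.+1 = 0 by rewrite subrr expr0n.
rewrite exprBn in h.
rewrite big_mkord; apply: etrans (etrans (congr1 ( *%R (j.+1)`!%:R^-1) h) (mulr0 _)).
rewrite mulr_sumr.
apply: eq_bigr => i _; rewrite !expr1n !mulr1 -[_ *+ 'C(_, _)]mulr_natr [RHS]mulrCA; congr (_ * _).
have ij : (i <= j.+1)%N by rewrite -ltnS.
have := bin_fact ij => /(congr1 (fun m => m%:R : R)) <-.
rewrite !natrM; field.
by rewrite ?nat1r !pnatr_eq0 -!lt0n !fact_gt0 bin_gt0 ij.
Qed.

Let dG0 : differential V th (G 0) f y.
Proof.
apply: eq_differential (dH 0) => t _ _; last by rewrite expr0 mulr1.
by rewrite /G big_nat1 !expr0 fact0 mulr1 divr1 !mul1r.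
Qed.

Let dG j : differential V th (G j.+1) (G j) y.
Proof.
have := @differential_sum _ V th j.+2 _ _ y (fun i _ =>
  differentialZ ((-1) ^+ i / ((j.+1 - i)`!%:R * i`!%:R))
  (differentialM th1 Vmono by_ yy (bounded01X (j.+1 - i) by_) (bH i)
    (bounded01M (bounded01_cst _) (bounded01X _ by_)) (bfy i)
    (differentialX th1 Vmono (j.+1 - i) by_ yy) (dH i))).
apply: eq_differential => // t _ _.
rewrite /G; under [RHS]eq_bigr do rewrite mulrDr.
(* In the second sum the powers of [y] recombine to [f t * y t ^+ j.+1] for every [i], so the
   alternating sum factors out. In the first, the index [i = j.+1] contributes 0 and the others give
   [G j]. *)
rewrite big_split/= [X in _ + X](_ : _ = 0) ?addr0.
  rewrite [in RHS]big_nat_recr//= subnn mul0r mul0r mulr0 addr0.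
  apply: eq_big_nat => i /= ij; rewrite ltnS in ij.
  rewrite subSn//= factS natrM.
  rewrite !mulrA; congr (_ * _ * _); field.
  by rewrite ?nat1r !pnatr_eq0 -!lt0n !fact_gt0.
apply: etrans (etrans (congr1 ( *%R^~ (f t * y t ^+ j.+1)) (sum_alternating j)) (mul0r _)).
rewrite /= mulr_suml.
apply: eq_big_nat => i /= ij; congr (_ * _).
by rewrite mulrCA -exprD subnK.
Qed.

Lemma iterated_integral_y (j : nat) (t : R) : 0 <= t -> t <= 1 ->
  iter j.+1 (step (1 : 'I_2)) (iter n.+1 (step (0 : 'I_2)) (fun=> 1)) t = G j t.
Proof.
have G0 i : G i 0 = 0.
  rewrite /G big1_seq// => l _.
  by rewrite /H (young_primitive0 th1 Vmono (fyy l)) !mulr0.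
have bG i : bounded01 (G i).
  elim: i => [|i IH]; first exact: (differential_bounded th1 Vmono bf by_ dG0).
  exact: (differential_bounded th1 Vmono IH by_ (dG i)).
have Gy i : compatible V th (G i) y.
  case: i => [|i]; first exact: (differential_compatible th1 Vmono bf by_ yy dG0).
  exact: (differential_compatible th1 Vmono (bG i) by_ yy (dG i)).
elim: j t => [|j IH] t t0 t1.
  rewrite iterS.
  rewrite (@young_integral_differential _ _ _ th1 Vmono f _ y _ (G 0) (gamma 0).2) //.
  - by rewrite G0 subr0.
  - by move=> s s0 s1; exact: iterated_integral_x.
  - by move=> s s0 s1; rewrite yE// subrK.
rewrite iterS.
rewrite (@young_integral_differential _ _ _ th1 Vmono (G j) _ y _ (G j.+1) (gamma 0).2) //.
- by rewrite G0 subr0.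
- by move=> s s0 s1; rewrite yE// subrK.
Qed.

(** Closedness enters through [y 1 = 0]: in [G k 1] only the term [i = k] survives, namely (-1)^k /
    k! times [H k 1]. The sums use exact increments of y^(k+1) / (k+1) because these are what
    integrating a staircase produces. *)
Lemma signature_limit (k : nat) : y 1 = 0 ->
  \sum_(0 <= i < 2 ^ m) x (dyadic m i) ^+ n.+1 / n.+1%:R *
    ((y (dyadic m i.+1) ^+ k.+1 - y (dyadic m i) ^+ k.+1) / k.+1%:R)
    @[m --> \oo] -->
  n`!%:R * k`!%:R * (-1) ^+ k *
  iterated_integral 0 1 gamma (nseq n.+1 (0 : 'I_2) ++ nseq k.+1 (1 : 'I_2)).
Proof.
move=> y1; rewrite /iterated_integral foldl_cat !foldl_nseq.
rewrite iterated_integral_y ?ler01// /G.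
rewrite big_nat_recr//= big_nat_cond big1 ?add0r => [|i]; last first.
  by rewrite andbT => /andP[_ ik]; rewrite y1 expr0n subn_eq0 leqNgt ik mul0r mulr0.
rewrite subnn expr0 mul1r fact0 mul1r.
have -> : n`!%:R * k`!%:R * (-1) ^+ k * ((-1) ^+ k / k`!%:R * H k 1) =
          n`!%:R * (H k 1 - H k 0).
  rewrite [H k 0](young_primitive0 th1 Vmono (fyy k)) subr0.
  move: (sqrr_sign R k); move: ((-1) ^+ k) (H k 1) => sg h s2.
  transitivity (n`!%:R * h * sg ^+ 2); last by rewrite s2 mulr1.
  field.
  by rewrite pnatr_eq0 -lt0n fact_gt0.
apply/cvgrPdist_le => e e0.
have Y : differential V th (fun t => k.+1%:R^-1 * y t ^+ k.+1) (fun t => y t ^+ k) y.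
  apply: eq_differential (differentialZ _ (differentialX th1 Vmono k.+1 by_ yy)) => //.
  by move=> t _ _; rewrite /= mulrA mulVf ?mul1r// pnatr_eq0.
(* Both d H_k and f d(y^(k+1) / (k+1)) equal f y^k d y up to an infinitesimal; [N] is the difference
   of the two remainders. *)
have N := infinitesimalD (dH k) (infinitesimalM (bounded01M (bounded01_cst (-1)) bf) Y).
have e'0 : 0 < e / n`!%:R by rewrite divr_gt0// ltr0n fact_gt0.
have [d d0 h] := infinitesimal_sum th1 Vmono N e'0.
have [m0 m0d] := dyadic_small d0.
exists m0 => // m /= m0m.
have := h (2 ^ m)%N (dyadic m) (dyadic_ge0 _ _ _)
  (fun i _ => dyadic_le _ m (leqnSn i)) (dyadic_le1 _ (leqnn _)).
move=> {}h.
have -> : H k 1 - H k 0 =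
    \sum_(0 <= i < 2 ^ m) (H k (dyadic m i.+1) - H k (dyadic m i)).
  by rewrite (telescope_sumr (fun i => H k (dyadic m i)))// dyadic1 dyadic0.
rewrite mulr_sumr -sumrB.
rewrite (eq_bigr (fun i => n`!%:R * (H k (dyadic m i.+1) - H k (dyadic m i) -
            f (dyadic m i) * y (dyadic m i) ^+ k * (y (dyadic m i.+1) - y (dyadic m i)) +
            -1 * f (dyadic m i) *
            (k.+1%:R^-1 * y (dyadic m i.+1) ^+ k.+1 - k.+1%:R^-1 * y (dyadic m i) ^+ k.+1 -
             y (dyadic m i) ^+ k * (y (dyadic m i.+1) - y (dyadic m i)))))).
  rewrite -mulr_sumr normrM ger0_norm// mulrC -ler_pdivlMr ?ltr0n ?fact_gt0//.
  apply: le_trans (ler_norm_sum _ _ _) _; apply: h => i _.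
  by rewrite dyadic_step m0d.
move=> i _; rewrite /f factS natrM; field.
by rewrite ?nat1r !pnatr_eq0 -!lt0n !fact_gt0.
Qed.

End iterated_integrals.

(** * Controls from finite p-variation *)

Definition uniformly_continuous01 {R : realType} (gamma : R -> R * R) : Prop :=
  forall e, 0 < e -> exists2 d, 0 < d & forall s t, 0 <= s -> s <= 1 ->
    0 <= t -> t <= 1 -> `|t - s| < d -> `|gamma t - gamma s| < e.

(** Compactness is used in its near-covering form, the modulus [d] tending to 0 from the right being
    the parameter. *)
Lemma within_continuous_uniform (R : realType) (gamma : R -> R * R) :
  {within `[0, 1], continuous gamma} -> uniformly_continuous01 gamma.
Proof.
move=> /subspace_continuousP cg e e0.
have /compact_near_coveringP cov := @segment_compact R 0 1.
have := cov R 0^'+ (fun d s => forall t, 0 <= s -> s <= 1 -> 0 <= t -> t <= 1 ->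
  `|t - s| < d -> `|gamma t - gamma s| < e) _ _.
case=> [s s01|d /= d0 h].
  have := cg s s01.
  have e2 : 0 < e / 2 by rewrite divr_gt0.
  move=> /cvgrPdist_lt/(_ _ e2).
  rewrite near_withinE => /nbhs_ballP[r /= r0 rg].
  have r2 : 0 < r / 2 by rewrite divr_gt0.
  exists (ball s (r / 2), `]0, (r / 2)[%classic).
    split; first exact: nbhsx_ballx.
    exists (r / 2) => //= u /=; rewrite sub0r normrN => ur u0.
    by rewrite in_itv/= u0; move: ur; rewrite gtr0_norm.
  move=> [s' d] /= [ss' /[!in_itv]/= /andP[d0 dr]] t s'0 s'1 t0 t1 ts'.
  rewrite /ball/= in ss'.
  have H1 : `|gamma s - gamma s'| < e / 2.
    apply: rg; last by rewrite /= in_itv/= s'0.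
    by rewrite /ball/=; lra.
  have H2 : `|gamma s - gamma t| < e / 2.
    apply: rg; last by rewrite /= in_itv/= t0.
    rewrite /ball/= -[s - t](subrKA s') (le_lt_trans (ler_normD _ _))//.
    by rewrite (distrC s' t); lra.
  rewrite -[_ - gamma s'](subrKA (gamma s)) (le_lt_trans (ler_normD _ _))//.
  by rewrite (distrC (gamma t)); lra.
exists (d / 2); first by rewrite divr_gt0.
move=> s t s0 s1 t0 t1 st.
apply: (h (d / 2)); rewrite ?divr_gt0//=.
- by rewrite sub0r normrN gtr0_norm ?divr_gt0//; lra.
- by rewrite in_itv/= s0.
Qed.

Lemma eucl_ge_norm (R : realType) (v : R * R) : `|v| <= eucl v.
Proof.
rewrite prod_normE ge_max /eucl; apply/andP; split.
  by rewrite -sqrtr_sqr ler_wsqrtr// lerDl sqr_ge0.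
by rewrite -sqrtr_sqr ler_wsqrtr// lerDr sqr_ge0.
Qed.

Section variation_control.
Variables (R : realType) (p : R) (gamma : R -> R * R).
Hypothesis p1 : 1 <= p.
Hypothesis p2 : p < 2.
Hypothesis ug : uniformly_continuous01 gamma.
Hypothesis vg : finite_pvariation p 0 1 gamma.

Lemma pvar_sum_rcons (s t : R) (S : seq R) : itv_partition 0 s S ->
  pvar_sum p 0 t gamma (rcons S t) =
  pvar_sum p 0 s gamma S + eucl (gamma t - gamma s) `^ p.
Proof.
move=> Ss; rewrite /pvar_sum size_rcons (big_nat_recr _ _ _ (leq0n _)).
have E k : (k <= size S)%N -> subdiv 0 t (rcons S t) k = subdiv 0 s S k.
  move=> kS; rewrite /subdiv -rcons_cons nth_rcons /= ltnS kS.
  (* The default value in [subdiv] is the right endpoint, which differs on the two sides; the index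
     is in range, so it is never read. *)
  exact: set_nth_default.
have -> : \sum_(0 <= k < size S) eucl (gamma (subdiv 0 t (rcons S t) k.+1) -
      gamma (subdiv 0 t (rcons S t) k)) `^ p =
    \sum_(0 <= k < size S) eucl (gamma (subdiv 0 s S k.+1) -
      gamma (subdiv 0 s S k)) `^ p.
  by apply: eq_big_nat => k /andP[_ kS]; rewrite (E k.+1 kS) (E k (ltnW kS)).
have -> : subdiv 0 t (rcons S t) (size S) = s.
  by rewrite (E _ (leqnn _)) /subdiv (itv_partition_nth_size _ Ss).
suff -> : subdiv 0 t (rcons S t) (size S).+1 = t by [].
by rewrite /subdiv [LHS]/= nth_rcons ltnn eqxx.
Qed.

Lemma itv_partition_rcons (s t : R) (S : seq R) : itv_partition 0 s S -> s < t ->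
  itv_partition 0 t (rcons S t).
Proof.
move=> [pS /eqP lS] st; split; last by rewrite last_rcons.
by rewrite rcons_path pS lS.
Qed.

Definition pvariation_upto (t : R) : R :=
  sup [set pvar_sum p 0 t gamma S | S in itv_partition 0 t].

Let set_nonempty t : 0 <= t ->
  [set pvar_sum p 0 t gamma S | S in itv_partition 0 t] !=set0.
Proof.
rewrite le_eqVlt => /predU1P[<-|t0].
  by exists (pvar_sum p 0 0 gamma [::]), [::].
by exists (pvar_sum p 0 t gamma [:: t]), [:: t] => //; exact: itv_partition1.
Qed.

(** Appending the point 1 turns a subdivision of [[0, t]] into one of [[0, 1]] and adds a
    nonnegative term to the sum. *)
Let set_bounded t : 0 <= t -> t <= 1 ->
  has_ubound [set pvar_sum p 0 t gamma S | S in itv_partition 0 t].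
Proof.
move=> t0 t1; have := vg; rewrite /finite_pvariation; set A := (X in ereal_sup X).
move=> supA.
have A1 S : itv_partition 0 1 S -> pvar_sum p 0 1 gamma S <= fine (ereal_sup A).
  move=> S1; have := @ereal_sup_ubound _ A (pvar_sum p 0 1 gamma S)%:E.
  have AS : A (pvar_sum p 0 1 gamma S)%:E by exists S.
  move=> /(_ AS); move: supA; by case: (ereal_sup A) => // r _; rewrite lee_fin.
exists (fine (ereal_sup A)) => _ [S St <-].
move: t1; rewrite [t <= 1]le_eqVlt => /orP[/eqP t1|t1].
  by move: St; rewrite t1; exact: A1.
apply: le_trans (A1 _ (itv_partition_rcons St t1)).
by rewrite (pvar_sum_rcons _ St) lerDl powR_ge0.
Qed.

(** Appending [t] to any subdivision of [[0, s]] adds the term of the step from [s] to [t]; then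
    take the supremum over these subdivisions. *)
Lemma pvariation_upto_increment (s t : R) : 0 <= s -> s < t -> t <= 1 ->
  `|gamma t - gamma s| `^ p <= pvariation_upto t - pvariation_upto s.
Proof.
move=> s0 st t1; have t0 : 0 <= t by lra.
rewrite lerBrDl -lerBrDr; apply: ge_sup; first exact: set_nonempty.
move=> _ [S Ss <-]; rewrite lerBrDr.
apply: (@le_trans _ _ (pvar_sum p 0 s gamma S + eucl (gamma t - gamma s) `^ p)).
  rewrite lerD2l ge0_ler_powR ?nnegrE ?eucl_ge_norm ?sqrtr_ge0//; move: p1; lra.
rewrite -(pvar_sum_rcons _ Ss); apply: ub_le_sup; first exact: set_bounded.
by exists (rcons S t) => //; exact: (itv_partition_rcons Ss st).
Qed.

Lemma pvariation_upto_mono (s t : R) : 0 <= s -> s <= t -> t <= 1 ->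
  pvariation_upto s <= pvariation_upto t.
Proof.
move=> s0; rewrite le_eqVlt => /predU1P[->//|st] t1.
rewrite -subr_ge0; apply: le_trans (pvariation_upto_increment s0 st t1).
exact: powR_ge0.
Qed.

(** The midpoint of 1 and 2 / p: above 1, as sewing requires, and below 2 / p, which leaves a
    positive power of the oscillation to spare. *)
Definition young_exponent : R := p^-1 + 2^-1.

Lemma young_exponent_gt1 : 1 < young_exponent.
Proof.
have p0 : 0 < p by move: p1; lra.
rewrite /young_exponent; suff : 2^-1 < p^-1 by lra.
by rewrite ltf_pV2// posrE.
Qed.

(* Since [p < 2], some power [`|gamma t - gamma s| `^ (1 - p / 2)] of the
   oscillation can be split off and absorbed in [e]. *)
Lemma increment_small (e : R) : 0 < e -> exists2 d, 0 < d &
  forall s t, 0 <= s -> s <= t -> t <= 1 -> t - s < d ->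
  `|gamma t - gamma s| ^+ 2 <= e * kappa pvariation_upto young_exponent s t.
Proof.
move=> e0; have p0 : 0 < p by move: p1; lra.
have q0 : 0 < 1 - p / 2 by move: p2; lra.
have r0 : 0 < e `^ (1 - p / 2)^-1 by rewrite powR_gt0.
have [d d0 h] := ug r0; exists d => // s t s0 st t1 std.
move: st; rewrite le_eqVlt => /predU1P[->|st].
  by rewrite subrr normr0 expr0n/= mulr_ge0 ?kappa_ge0 ?(ltW e0).
have s1 : s <= 1 by lra.
have t0 : 0 <= t by lra.
have std' : `|t - s| < d by rewrite gtr0_norm// subr_gt0.
have {}h := h s t s0 s1 t0 t1 std'.
have V := pvariation_upto_increment s0 st t1.
move: V h; move: (normr_ge0 (gamma t - gamma s)).
move: `|_| => u u0 V h.
(* Here [p * young_exponent = 1 + p / 2]. *)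
have -> : u ^+ 2 = u `^ (1 - p / 2) * (u `^ p) `^ young_exponent.
  rewrite -powRrM -powRD.
    rewrite -powR_mulrn//; congr powR; rewrite /young_exponent.
    by field; rewrite gt_eqF.
  apply/implyP => /eqP h0; exfalso; clear V h.
  by move: h0; rewrite /young_exponent mulrDr mulfV ?gt_eqF//; lra.
apply: ler_pM; rewrite ?powR_ge0//.
  apply: le_trans (_ : (e `^ (1 - p / 2)^-1) `^ (1 - p / 2) <= _).
    by rewrite ge0_ler_powR ?nnegrE ?powR_ge0// ltW.
  by rewrite -powRrM mulVf ?gt_eqF// powRr1// ltW.
rewrite ge0_ler_powR ?nnegrE ?powR_ge0//.
  by apply: ltW; apply: lt_trans young_exponent_gt1.
by apply: le_trans V; exact: powR_ge0.
Qed.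

(** A product of two increments is at most half the sum of their squares, and [increment_small]
    bounds each square. *)
Lemma compatible_coordinates (f g : R -> R) :
  (forall s t, 0 <= s -> s <= t -> t <= 1 ->
    `|f t - f s| <= `|gamma t - gamma s|) ->
  (forall s t, 0 <= s -> s <= t -> t <= 1 ->
    `|g t - g s| <= `|gamma t - gamma s|) ->
  compatible pvariation_upto young_exponent f g.
Proof.
move=> fg gg e e0; have [d d0 h] := increment_small e0.
exists d => // a b s t s' t' a0 b1 bad as_ st tb as' st' tb'.
have Vm := pvariation_upto_mono.
have K u v : a <= u -> u <= v -> v <= b ->
    `|gamma v - gamma u| ^+ 2 <= e * kappa pvariation_upto young_exponent a b.
  move=> au uv vb; have u0 := le_trans a0 au; have v1 := le_trans vb b1.
  have vud : v - u < d by clear -bad au vb; lra.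
  apply: le_trans (h u v u0 uv v1 vud) _.
  apply: ler_wpM2l; first exact: ltW.
  exact: (kappa_mono young_exponent_gt1 Vm a0 au uv vb b1).
have sq (u v : R) : 0 <= u -> u <= v -> u ^+ 2 <= v ^+ 2.
  by move=> u0 uv; rewrite ler_pXn2r// nnegrE// (le_trans u0 uv).
have H1 := le_trans (sq _ _ (normr_ge0 _)
  (fg s t (le_trans a0 as_) st (le_trans tb b1))) (K s t as_ st tb).
have H2 := le_trans (sq _ _ (normr_ge0 _)
  (gg s' t' (le_trans a0 as') st' (le_trans tb' b1))) (K s' t' as' st' tb').
clear -H1 H2; move: H1 H2; set k := (e * _).
have := sqr_ge0 (`|f t - f s| - `|g t' - g s'|); rewrite sqrrB; lra.
Qed.

End variation_control.

(** * Winding numbers as crossing numbers *)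

Section plane_angles.
Variable R : realType.
Implicit Types a b z : R * R.

Definition dot a b : R := a.1 * b.1 + a.2 * b.2.

Definition cross a b : R := a.1 * b.2 - a.2 * b.1.

(* The angle from [a] to [b], meaningful when [0 < dot a b]. *)
Definition turn a b : R := atan (cross a b / dot a b).

Definition polar a (t : R) : Prop := cos t = a.1 / eucl a /\ sin t = a.2 / eucl a.

(* The argument of [a] in ]0, 2 pi], discontinuous across the positive x axis. *)
Definition arg02pi a : R :=
  if 0 < a.2 then acos (a.1 / eucl a) else 2 * pi - acos (a.1 / eucl a).

Lemma sqr_eucl a : eucl a ^+ 2 = a.1 ^+ 2 + a.2 ^+ 2.
Proof. by rewrite sqr_sqrtr// addr_ge0// sqr_ge0. Qed.

Lemma eucl_gt0 a : a != 0 -> 0 < eucl a.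
Proof.
move=> a0; apply: lt_le_trans (eucl_ge_norm a).
by rewrite normr_gt0.
Qed.

Lemma dot_gt0_neq0 a b : 0 < dot a b -> a != 0 /\ b != 0.
Proof.
move=> ab; split; apply/eqP => E; move: ab;
  by rewrite E /dot/= ?mul0r ?mulr0 addr0 ltxx.
Qed.

(** Lagrange's identity: the squares of [dot a b] and [cross a b] add up to the square of
    [eucl a * eucl b]. *)
Lemma cos_turn a b : 0 < dot a b -> cos (turn a b) = dot a b / (eucl a * eucl b).
Proof.
move=> ab; have [a0 b0] := dot_gt0_neq0 ab.
have ea := eucl_gt0 a0; have eb := eucl_gt0 b0.
rewrite /turn cos_atan -[RHS]invrK; congr (_^-1).
rewrite invfM invrK -[RHS]ger0_norm; last first.
  by apply: mulr_ge0; rewrite ?invr_ge0 ?mulr_ge0// ltW.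
rewrite -sqrtr_sqr; congr Num.sqrt.
rewrite !exprMn exprVn !sqr_eucl /cross.
have : dot a b != 0 by rewrite gt_eqF.
by rewrite /dot => ?; field.
Qed.

Lemma sin_turn a b : 0 < dot a b -> sin (turn a b) = cross a b / (eucl a * eucl b).
Proof.
move=> ab; have [a0 b0] := dot_gt0_neq0 ab.
have ea := eucl_gt0 a0; have eb := eucl_gt0 b0.
have dn : dot a b != 0 by rewrite gt_eqF.
have c0 : cos (turn a b) != 0.
  by rewrite cos_turn// mulf_neq0// invr_neq0// mulf_neq0// gt_eqF.
have -> : sin (turn a b) = tan (turn a b) * cos (turn a b) by rewrite /tan divfK.
rewrite {1}/turn atanK cos_turn//; field.
by rewrite dn !gt_eqF.
Qed.

Lemma polarD_turn a b t : 0 < dot a b -> polar a t -> polar b (t + turn a b).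
Proof.
move=> ab [ct st]; have [a0 b0] := dot_gt0_neq0 ab.
have ea := eucl_gt0 a0; have eb := eucl_gt0 b0.
have E := sqr_eucl a.
split; rewrite ?cosD ?sinD ct st cos_turn// sin_turn//.
  transitivity (b.1 * (a.1 ^+ 2 + a.2 ^+ 2) / (eucl a ^+ 2 * eucl b)).
    by rewrite /dot /cross; field; rewrite !gt_eqF.
  by rewrite -E; field; rewrite !gt_eqF.
transitivity (b.2 * (a.1 ^+ 2 + a.2 ^+ 2) / (eucl a ^+ 2 * eucl b)).
  by rewrite /dot /cross; field; rewrite !gt_eqF.
by rewrite -E; field; rewrite !gt_eqF.
Qed.

Lemma cosB_polar a t t' : a != 0 -> polar a t -> polar a t' -> cos (t - t') = 1.
Proof.
move=> a0 [ct st] [ct' st']; have ea := eucl_gt0 a0.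
rewrite cosB ct ct' st st' -!expr2 !exprMn -mulrDl -sqr_eucl exprVn divff//.
by rewrite expf_neq0// gt_eqF.
Qed.

(** Half angles: cos t = 1 forces sin (t / 2) = 0. The lemma turns equality of angles modulo 2 pi
    into equality. *)
Lemma cos_eq1_small (t : R) : cos t = 1 -> `|t| < 2 * pi -> t = 0.
Proof.
move=> ct t2.
have s0 : sin (t / 2) = 0.
  apply/eqP; rewrite -sqrf_eq0 sin2cos2; apply/eqP.
  have := cos_mulr2n (t / 2); rewrite -[_ *+ 2]mulr_natr divfK ?pnatr_eq0// ct.
  by rewrite -mulr_natr => h; lra.
have H (u : R) : 0 < u -> u < 2 * pi -> sin (u / 2) <> 0.
  move=> u0 u2; apply/eqP; rewrite gt_eqF// sin_gt0_pi//.
  by apply/andP; split; lra.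
apply/eqP; rewrite eq_le; apply/andP; split; rewrite leNgt; apply/negP => t0.
  have t2' : t < 2 * pi by move: t2; rewrite gtr0_norm.
  exact: (H _ t0 t2' s0).
have t2' : - t < 2 * pi by rewrite -ltr0_norm.
have t0' : 0 < - t by lra.
by apply: (H _ t0' t2'); rewrite mulNr sinN s0 oppr0.
Qed.

Lemma arg_ratio_itv a : a != 0 -> -1 <= a.1 / eucl a <= 1.
Proof.
move=> /eucl_gt0 ea.
rewrite ler_pdivlMr// ler_pdivrMr// mul1r mulN1r -ler_norml.
apply: le_trans (eucl_ge_norm a).
by rewrite prod_normE le_max lexx.
Qed.

Lemma polar_arg02pi a : a != 0 -> polar a (arg02pi a).
Proof.
move=> a0; have ea := eucl_gt0 a0; have I := arg_ratio_itv a0.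
have s2 : Num.sqrt (1 - (a.1 / eucl a) ^+ 2) = `|a.2| / eucl a.
  rewrite -[RHS]ger0_norm; last by rewrite divr_ge0// ltW.
  rewrite -sqrtr_sqr; congr Num.sqrt.
  rewrite !exprMn exprVn real_normK ?num_real//.
  have E := sqr_eucl a.
  have -> : a.2 ^+ 2 = eucl a ^+ 2 - a.1 ^+ 2 by rewrite E addrAC subrr add0r.
  by field; rewrite gt_eqF.
have Ic : a.1 / eucl a \in `[-1, 1] by rewrite in_itv.
rewrite /arg02pi /polar; case: ifPn => [a2|].
  by rewrite acosK// sin_acos// s2 gtr0_norm.
rewrite -leNgt => a2.
have -> : 2 * pi - acos (a.1 / eucl a) = - acos (a.1 / eucl a) + pi *+ 2.
  by rewrite addrC mulr_natl.
rewrite cosD2pi sinD2pi cosN sinN acosK// sin_acos// s2 ler0_norm//.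
by rewrite mulNr opprK.
Qed.

Lemma arg02pi_upper a : 0 < a.2 -> 0 < arg02pi a < pi.
Proof.
move=> a2; have a0 : a != 0.
  by apply/eqP => E; move: a2; rewrite E ltxx.
have ea := eucl_gt0 a0; rewrite /arg02pi a2.
have n1 : `|a.1| < eucl a.
  rewrite -sqrtr_sqr ltr_sqrt ?ltrDl ?exprn_gt0//.
  by rewrite ltr_wpDl ?sqr_ge0 ?exprn_gt0.
move: n1; rewrite ltr_norml => /andP[n1 n2].
have l1 : -1 < a.1 / eucl a by rewrite ltr_pdivlMr// mulN1r.
have l2 : a.1 / eucl a < 1 by rewrite ltr_pdivrMr// mul1r.
by rewrite acos_gt0 ?acos_ltpi// ?l1 ?l2 ?(ltW l1) ?(ltW l2).
Qed.

Lemma arg02pi_lower a : a != 0 -> a.2 <= 0 -> pi <= arg02pi a <= 2 * pi.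
Proof.
move=> a0 a2; rewrite /arg02pi ltNge a2/=; have I := arg_ratio_itv a0.
by have := acos_ge0 I; have := acos_lepi I => *; apply/andP; split; lra.
Qed.

Lemma turn_itv a b : - (pi / 2) < turn a b < pi / 2.
Proof. by rewrite /turn atan_gtNpi2 atan_ltpi2. Qed.

Lemma turn_gt0 a b : 0 < dot a b -> (0 < turn a b) = (0 < cross a b).
Proof.
move=> ab; have [c0|c0] := ltP 0 (cross a b).
  by rewrite -(atan0 R) lt_atan// divr_gt0.
apply/negbTE; rewrite -leNgt -(atan0 R) le_atan// mulr_le0_ge0// invr_ge0.
exact: ltW.
Qed.

Lemma turn_lt0 a b : 0 < dot a b -> (turn a b < 0) = (cross a b < 0).
Proof.
move=> ab; have [c0|c0] := ltP (cross a b) 0.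
  by rewrite -(atan0 R) lt_atan// pmulr_llt0 ?invr_gt0.
apply/negbTE; rewrite -leNgt -(atan0 R) le_atan// divr_ge0//.
exact: ltW.
Qed.

(** Signed crossing of the positive x axis by the vertical edge from [a] to height [b.2]. Points on
    the axis count as below it, in agreement with [arg02pi], which is 2 pi there. *)
Definition crossing a b : R :=
  ((0 < b.2)%R%:R - (0 < a.2)%R%:R) * (0 < a.1)%R%:R.

Section small_step.
Variables (d : R) (a b : R * R).
Hypothesis d0 : 0 < d.
Hypothesis ad : d <= `|a|.
Hypothesis abd : `|b - a| < d / 2.

Lemma dot_small_step : 0 < dot a b.
Proof.
move: d0 ad abd; rewrite !prod_normE le_max gt_max /= => d0' ad' /andP[].
rewrite !ltr_norml => /andP[h1 h2] /andP[h3 h4]; rewrite /dot.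
have -> : a.1 * b.1 + a.2 * b.2 = (a.1 ^+ 2 + a.2 ^+ 2)
   + a.1 * (b.1 - a.1) + a.2 * (b.2 - a.2) by ring.
(* Applied to both coordinates, this leaves at least half the squared Euclidean norm of [a] minus
   d^2 / 4, hence at least d^2 / 4. *)
have E (u e : R) : - (d / 2) <= e -> e <= d / 2 ->
    - (u ^+ 2 + d ^+ 2 / 4) / 2 <= u * e.
  move=> e1 e2; have ed : e ^+ 2 <= d ^+ 2 / 4 by nra.
  by have := sqr_ge0 (u + e); rewrite sqrrD; lra.
have H1 := E a.1 (b.1 - a.1) (ltW h1) (ltW h2).
have H2 := E a.2 (b.2 - a.2) (ltW h3) (ltW h4).
have dd : 0 < d ^+ 2 by rewrite exprn_gt0.
have a2 : d ^+ 2 <= a.1 ^+ 2 + a.2 ^+ 2.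
  have p (u : R) : d <= `|u| -> d ^+ 2 <= u ^+ 2.
    move=> du; rewrite -(real_normK (num_real u)) ler_pXn2r// nnegrE.
    exact: ltW.
  have := sqr_ge0 a.1; have := sqr_ge0 a.2.
  by case/orP: ad' => /p; lra.
lra.
Qed.

(** A step across the x axis has [a.2] small, so the sup norm of [a] is attained by [a.1], whose
    sign a small step cannot change. Hence it does not matter that [crossing] reads the first
    coordinate of [a] alone. *)
Lemma first_coord_small_step : (0 < a.2) != (0 < b.2) ->
  (0 < a.1) = (0 < b.1) /\ a.1 != 0.
Proof.
move: d0 ad abd; rewrite !prod_normE le_max gt_max /= => d0' ad' /andP[].
rewrite !ltr_norml => /andP[h1 h2] /andP[h3 h4] ab2.
have a2d : `|a.2| < d.
  move: ab2; rewrite ltr_norml.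
  by have [q1|q1] := ltP 0 a.2; have [q2|q2] := ltP 0 b.2 => // _;
    apply/andP; split; lra.
have {}ad' : d <= `|a.1| by case/orP: ad' => //; rewrite leNgt a2d.
have [a1|a1] := ltP 0 a.1.
  by rewrite gtr0_norm// in ad'; split; [apply/esym; lra | rewrite gt_eqF].
rewrite ler0_norm// in ad'; split; last by rewrite lt_eqF//; lra.
by apply/esym/negbTE; rewrite -leNgt; lra.
Qed.

Lemma crossing_small_step :
  [\/ (0 < a.2) = (0 < b.2) /\ crossing a b = 0,
      a.2 <= 0 < b.2 /\
        (0 < cross a b /\ crossing a b = 1 \/ cross a b <= 0 /\ crossing a b = 0) |
      b.2 <= 0 < a.2 /\
        (cross a b < 0 /\ crossing a b = -1 \/ 0 <= cross a b /\ crossing a b = 0)].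
Proof.
have := first_coord_small_step; rewrite /crossing /cross.
have [a2|a2] := ltP 0 a.2; have [b2|b2] := ltP 0 b.2 => /=.
- by move=> _; constructor 1; rewrite subrr mul0r.
- move=> /(_ isT)[p p0]; constructor 3; split => //.
  move: p p0; have [a1|a1] := ltP 0 a.1 => /esym b1 an.
    left; split; last by rewrite sub0r mulr1.
    have := mulr_gt0 a2 b1; have := mulr_ge0_le0 (ltW a1) b2; lra.
  right; split; last by rewrite mulr0.
  move/negbT: b1; rewrite -leNgt => b1.
  have := mulr_ge0_le0 (ltW a2) b1; have := mulr_le0 a1 b2; lra.
- move=> /(_ isT)[p p0]; constructor 2; split => //.
  move: p p0; have [a1|a1] := ltP 0 a.1 => /esym b1 an.
    left; split; last by rewrite subr0 mulr1.
    have := mulr_gt0 a1 b2; have := mulr_le0_ge0 a2 (ltW b1); lra.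
  right; split; last by rewrite mulr0.
  move/negbT: b1; rewrite -leNgt => b1.
  have := mulr_le0 a2 b1; have := mulr_le0_ge0 a1 (ltW b2); lra.
- by move=> _; constructor 1; rewrite subrr mul0r.
Qed.

(** Both [arg02pi a + turn a b] and [arg02pi b] are arguments of [b], so the two sides agree modulo
    2 pi. Locating the angles by half-planes, with the sign of the turn read from [cross a b], shows
    that they differ by less than 2 pi. *)
Lemma turn_arg02pi :
  turn a b = arg02pi b - arg02pi a + 2 * pi * crossing a b.
Proof.
have ab := dot_small_step; have [a0 b0] := dot_gt0_neq0 ab.
have C := cosB_polar b0 (polarD_turn ab (polar_arg02pi a0)) (polar_arg02pi b0).
have P : 0 < pi :> R := pi_gt0 R.
have /andP[t1 t2] := turn_itv a b.
have tp := turn_gt0 ab; have tn := turn_lt0 ab.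
apply/eqP; rewrite -subr_eq0; apply/eqP.
apply: cos_eq1_small.
  have [c ->] : exists c : bool * bool, crossing a b = c.1%:R - c.2%:R.
    case: crossing_small_step => [[_ ->]|[_ [[_ ->]|[_ ->]]]|[_ [[_ ->]|[_ ->]]]].
    - by exists (false, false); rewrite subrr.
    - by exists (true, false); rewrite subr0.
    - by exists (false, false); rewrite subrr.
    - by exists (false, true); rewrite sub0r.
    - by exists (false, false); rewrite subrr.
  have -> : turn a b - (arg02pi b - arg02pi a + 2 * pi * (c.1%:R - c.2%:R)) =
     (arg02pi a + turn a b - arg02pi b) + (- (pi *+ 2)) *+ c.1 + (pi *+ 2) *+ c.2.
    by case: c => [[] []] /=; rewrite ?mulr1n ?mulr0n; ring.
  have pN u : cos (u + - (pi *+ 2)) = cos u.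
    by rewrite -[in RHS](subrK (pi *+ 2) u) cosD2pi.
  by case: c => [[] []] /=; rewrite ?mulr1n ?mulr0n ?addr0 ?cosD2pi ?pN.
have up (v : R * R) : 0 < v.2 -> 0 < arg02pi v < pi := @arg02pi_upper v.
have lo (v : R * R) : v != 0 -> v.2 <= 0 -> pi <= arg02pi v <= 2 * pi := @arg02pi_lower v.
rewrite ltr_norml.
case: crossing_small_step => [[E ->]|[/andP[a2 b2] H]|[/andP[b2 a2] H]].
- rewrite mulr0 addr0; move: E; have [a2|a2] := ltP 0 a.2.
    move=> /esym b2; have /andP[u1 u2] := up _ a2; have /andP[u3 u4] := up _ b2.
    by apply/andP; split; lra.
  move=> /esym/negbT; rewrite -leNgt => b2.
  have /andP[u1 u2] := lo _ a0 a2; have /andP[u3 u4] := lo _ b0 b2.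
  by apply/andP; split; lra.
- have /andP[u1 u2] := lo _ a0 a2; have /andP[u3 u4] := up _ b2.
  case: H => [[c ->]|[c ->]].
    by rewrite c in tp; apply/andP; split; lra.
  move: c; rewrite leNgt -tp -leNgt => c.
  by apply/andP; split; lra.
- have /andP[u1 u2] := up _ a2; have /andP[u3 u4] := lo _ b0 b2.
  case: H => [[c ->]|[c ->]].
    by rewrite c in tn; apply/andP; split; lra.
  move: c; rewrite leNgt -tn -leNgt => c.
  by apply/andP; split; lra.
Qed.

End small_step.
End plane_angles.

(** * Angle lifts along dyadic points and the winding number *)

Section winding_number.
Variables (R : realType) (gamma : R -> R * R).
Hypothesis ug : uniformly_continuous01 gamma.

(** Composing with it extends the curve by constants to a function continuous on the whole line. *)
Definition clamp01 (s : R) : R := Num.max 0 (Num.min s 1).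

Lemma clamp01_itv (s : R) : 0 <= clamp01 s /\ clamp01 s <= 1.
Proof.
rewrite /clamp01 le_max lexx/=; split => //.
by rewrite ge_max ler01 ge_min lexx orbT.
Qed.

Lemma clamp01_id (s : R) : 0 <= s -> s <= 1 -> clamp01 s = s.
Proof. by move=> s0 s1; rewrite /clamp01 min_l// max_r. Qed.

Lemma clamp01_lip (s t : R) : `|clamp01 s - clamp01 t| <= `|s - t|.
Proof.
rewrite /clamp01 /Order.max /Order.min; rewrite ler_norml.
have := ler_norm (s - t); have := lerNnormlW (lexx `|s - t|).
case: (ltP s 1) => ?; case: (ltP t 1) => ?; case: ltP => ?; case: ltP => ? ? ?;
  apply/andP; split; lra.
Qed.

Lemma continuous_clamped : continuous (gamma \o clamp01).
Proof.
move=> s; apply/cvgrPdist_lt => e e0; have [d d0 h] := ug e0.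
near=> t.
have [a0 a1] := clamp01_itv s; have [b0 b1] := clamp01_itv t.
apply: (h (clamp01 t) (clamp01 s)) => //; apply: le_lt_trans (clamp01_lip _ _) _.
near: t; exact: cvgr_dist_lt.
Unshelve. all: by end_near. Qed.

Variable z : R * R.
Hypothesis gz : forall s, 0 <= s -> s <= 1 -> gamma s != z.

Let v (s : R) : R * R := gamma (clamp01 s) - z.

Let cv : continuous v.
Proof. by move=> s; apply: cvgB; [exact: continuous_clamped|exact: cvg_cst]. Qed.

Lemma distance_to_curve : exists2 d, 0 < d & forall s, d <= `|v s|.
Proof.
have cn : {within `[0, 1], continuous (fun s => `|v s|)}.
  apply: continuous_subspaceT => s; apply: cvg_norm; exact: cv.
have [c /[!in_itv]/= /andP[c0 c1] h] := EVT_min ler01 cn.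
exists `|v c|; first by rewrite normr_gt0 /v clamp01_id// subr_eq0 gz.
move=> s; have [a0 a1] := clamp01_itv s.
have := h (clamp01 s); rewrite in_itv/= a0 a1 => /(_ isT).
by rewrite {2}/v [clamp01 (clamp01 s)]clamp01_id.
Qed.

Section lift.
Variables (m : nat) (d : R).
Hypothesis d0 : 0 < d.
Hypothesis vd : forall s, d <= `|v s|.
Hypothesis vm : forall s t, `|t - s| <= 1 / 2 ^+ m -> `|v t - v s| < d / 2.

Let u (s : R) (i : nat) := v (Num.min (dyadic m i) s).

Let us (s : R) i : 0 <= s -> `|u s i.+1 - u s i| < d / 2.
Proof.
move=> s0; apply: vm; rewrite -(dyadic_step R m i).
have := @dyadic_le R m _ _ (leqnSn i).
rewrite /Order.min; case: ltP => ?; case: ltP => ?; rewrite ler_norml => ?;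
  apply/andP; split; lra.
Qed.

(** The angle accumulated along the dyadic points stopped at [s]. Steps after [s] are trivial and
    turn by 0, and each turn depends continuously on [s]. *)
Definition explicit_lift (s : R) : R :=
  arg02pi (v 0) + \sum_(0 <= i < 2 ^ m) turn (u s i) (u s i.+1).

Lemma explicit_lift_polar s : 0 <= s -> s <= 1 -> polar (v s) (explicit_lift s).
Proof.
move=> s0 s1.
have H j : polar (u s j) (arg02pi (v 0) + \sum_(0 <= i < j) turn (u s i) (u s i.+1)).
  elim: j => [|j IH].
    rewrite big_nil addr0 /u dyadic0 min_l//; apply: polar_arg02pi.
    by rewrite -normr_gt0 (lt_le_trans d0).
  rewrite big_nat_recr// addrA; apply: polarD_turn => //.
  apply: (@dot_small_step _ d) => //; first exact: vd.
  exact: us.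
have := H (2 ^ m)%N; rewrite {1}/u dyadic1 min_r//.
Qed.

Lemma explicit_lift_continuous : {within `[0, 1], continuous explicit_lift}.
Proof.
apply/subspace_continuousP => s /=; rewrite in_itv/= => /andP[s0 s1].
apply: cvg_within_filter.
apply: cvgD; first exact: cvg_cst.
have cu i : u t i @[t --> s] --> u s i.
  apply: continuous_cvg; first exact: cv.
  apply: (@continuous_min R R (fun=> dyadic m i) id s); first exact: cvg_cst.
  exact: cvg_id.
have cu1 i : (u t i).1 @[t --> s] --> (u s i).1.
  by apply: continuous_cvg; [exact: cvg_fst|exact: cu].
have cu2 i : (u t i).2 @[t --> s] --> (u s i).2.
  by apply: continuous_cvg; [exact: cvg_snd|exact: cu].
apply: (cvg_big add_continuous) => i _; apply: continuous_cvg; first exact: continuous_atan.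
apply: cvgM.
  by apply: cvgB; apply: cvgM.
apply: cvgV.
  by rewrite gt_eqF//; apply: (@dot_small_step _ d) => //; [exact: vd|exact: us].
by apply: cvgD; apply: cvgM.
Qed.

(** By [turn_arg02pi] the arguments telescope and cancel since the curve is closed; only the
    crossings remain. *)
Lemma explicit_lift_winding : gamma 0 = gamma 1 ->
  explicit_lift 1 - explicit_lift 0 = 2 * pi *
  \sum_(0 <= i < 2 ^ m) crossing (gamma (dyadic m i) - z) (gamma (dyadic m i.+1) - z).
Proof.
move=> g01; rewrite /explicit_lift opprD addrACA subrr add0r.
rewrite [X in _ - X]big1 ?subr0; last first.
  move=> i _; rewrite /u !min_r ?dyadic_ge0// /turn /cross (mulrC (v 0).2) subrr mul0r.
  exact: atan0.
rewrite (eq_big_nat _ _ (F2 := fun i => (arg02pi (v (dyadic m i.+1)) -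
    arg02pi (v (dyadic m i))) + 2 * pi * crossing (gamma (dyadic m i) - z)
    (gamma (dyadic m i.+1) - z))); last first.
  move=> i /= im.
  rewrite (turn_arg02pi d0 (vd _) (us _ ler01)).
  by rewrite /u !min_l ?dyadic_le1 ?(ltnW im)// /v !clamp01_id ?dyadic_ge0
    ?dyadic_le1 ?(ltnW im).
rewrite big_split/= -mulr_sumr (telescope_sumr (fun i => arg02pi (v (dyadic m i))))//.
by rewrite dyadic1 dyadic0 /v !clamp01_id// g01 subrr add0r.
Qed.

(** The difference [D] of two lifts has cosine 1 throughout. If it moved by 2 pi or more it would
    pass through D 0 + pi or D 0 - pi, where the cosine is -1. *)
Lemma lift_increment_unique g : angle_lift gamma z g ->
  g 1 - g 0 = explicit_lift 1 - explicit_lift 0.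
Proof.
move=> [cg gp]; pose D s := g s - explicit_lift s.
have cD : {within `[0, 1], continuous D}.
  by move=> s; apply: cvgB; [exact: cg|exact: explicit_lift_continuous].
have D1 s : 0 <= s -> s <= 1 -> cos (D s) = 1.
  move=> s0 s1; apply: (@cosB_polar _ (v s)).
  - by rewrite -normr_gt0 (lt_le_trans d0).
  - by rewrite /v clamp01_id//; apply: gp; rewrite in_itv/= s0.
  - exact: explicit_lift_polar.
suff E : D 1 - D 0 = 0 by move: E; rewrite /D; lra.
have cosP (s : bool) : cos (D 0 + (-1) ^+ s * pi) = -1.
  have c0 := D1 0 (lexx 0) ler01.
  case: s; rewrite ?expr1 ?expr0 ?mulN1r ?mul1r cosD ?cosN ?sinN sinpi cospi c0.
    by rewrite oppr0 mulr0 subr0 mul1r.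
  by rewrite mulr0 subr0 mul1r.
have n1 : (1 : R) <> -1 by move=> h; lra.
have pp : 0 < pi :> R := pi_gt0 R.
apply: cos_eq1_small.
  have s0 := cos1sin0; rewrite cosB !D1//.
  have -> : sin (D 0) = 0 by apply: s0; rewrite D1// normr1.
  by rewrite mulr0 addr0 mulr1.
rewrite ltNge; apply/negP => big.
have [s s01 Ds] : exists2 s, s \in `[0, 1] &
    D s = D 0 + (-1) ^+ (D 1 < D 0)%R * pi.
  apply: IVT => //; rewrite ge_min le_max; move: big.
  case: (ltP (D 1) (D 0)) => h; rewrite ?expr1 ?expr0.
    by rewrite ltr0_norm ?subr_lt0// => b; apply/andP; split; apply/orP; [right|left]; lra.
  by rewrite ger0_norm ?subr_ge0// => b; apply/andP; split; apply/orP; [left|right]; lra.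
move: s01; rewrite in_itv/= => /andP[s0 s1].
by have := D1 s s0 s1; rewrite Ds cosP => /esym.
Qed.

End lift.

(** [m0] depends on the distance from [z] to the curve, so the convergence is only pointwise off the
    curve. *)
Lemma winding_crossing : gamma 0 = gamma 1 ->
  exists m0, forall m, (m0 <= m)%N -> winding gamma z =
  \sum_(0 <= i < 2 ^ m) crossing (gamma (dyadic m i) - z) (gamma (dyadic m i.+1) - z).
Proof.
move=> g01; have [d d0 vd] := distance_to_curve.
have d2 : 0 < d / 2 by rewrite divr_gt0.
have [e e0 h] := ug d2; have [m0 m0e] := dyadic_small e0.
exists m0 => m m0m.
have vm s t : `|t - s| <= 1 / 2 ^+ m -> `|v t - v s| < d / 2.
  move=> ts; rewrite /v opprD addrACA opprK addNr addr0.
  have [a0 a1] := clamp01_itv s; have [b0 b1] := clamp01_itv t.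
  apply: h => //; apply: le_lt_trans (clamp01_lip _ _) _.
  exact: le_lt_trans ts (m0e _ m0m).
have P : 2 * pi != 0 :> R by rewrite mulf_neq0// gt_eqF// pi_gt0.
have L : angle_lift gamma z (explicit_lift m).
  split; first exact: (explicit_lift_continuous d0 vd vm).
  move=> s; rewrite in_itv/= => /andP[s0 s1].
  have := explicit_lift_polar d0 vd vm s0 s1.
  by rewrite /v clamp01_id.
rewrite /winding; set A := [set _ | _ in _].
have [g gL <-] : A (xget 0 A).
  apply: (@xgetPex _ 0 A).
  by exists ((explicit_lift m 1 - explicit_lift m 0) / (2 * pi)), (explicit_lift m).
rewrite (lift_increment_unique d0 vd vm gL) (explicit_lift_winding d0 vd vm g01).
by rewrite mulrC mulKf.
Qed.

End winding_number.

(** * Integrals over the plane *)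

Section half_line_indicators.
Variable R : realType.
Local Notation mu := (@lebesgue_measure R).

(** Strict, and written with a difference, to match [crossing] at points shifted by [z]. *)
Definition step (b u : R) : R := (0 < b - u)%R%:R.

Lemma step_diff (a b u : R) : a <= b -> step b u - step a u = \1_(`[a, b[) u.
Proof.
move=> ab; rewrite /step indicE mem_setE in_itv/= !subr_gt0.
have [ua|ua] := ltP u a; first by rewrite (lt_le_trans ua ab) subrr.
by rewrite subr0.
Qed.

Definition monomial_strip (n : nat) (a b u : R) : R := u ^+ n * (step b u - step a u).

Lemma monomial_strip_sym n a b u :
  monomial_strip n a b u = - monomial_strip n b a u.
Proof. by rewrite /monomial_strip -mulrN opprB. Qed.

Lemma monomial_stripE n a b : a <= b ->
  EFin \o monomial_strip n a b = (EFin \o (fun u => u ^+ n)) \_ (`[a, b[%classic).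
Proof.
move=> ab; apply/funext => u; rewrite /monomial_strip /= step_diff// indicE patchE.
by case: ifP => /= _; rewrite ?mulr1 ?mulr0.
Qed.

Lemma continuous_monomial n : continuous (fun u : R => u ^+ n).
Proof. by move=> u; exact: exprn_continuous. Qed.

Lemma integrable_monomial_strip n a b :
  mu.-integrable setT (EFin \o monomial_strip n a b).
Proof.
have H c d : c <= d -> mu.-integrable setT (EFin \o monomial_strip n c d).
  move=> cd; rewrite monomial_stripE//; apply: (iffLR (integrable_mkcond _ _)) => //.
  have I : mu.-integrable `[c, d] (EFin \o (fun u : R => u ^+ n)).
    apply: continuous_compact_integrable; first exact: segment_compact.
    by apply: continuous_subspaceT; exact: continuous_monomial.
  apply: (integrableS _ _ _ I) => //.
  by apply: subset_itv => //; rewrite bnd_simp.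
have [|/ltW] := leP a b; first exact: H.
move=> /H/integrableN; congr (integrable _ _ _).
by apply/funext => u /=; rewrite [in RHS]monomial_strip_sym EFinN.
Qed.

Lemma integral_monomial_strip n a b :
  (\int[mu]_u (monomial_strip n a b u)%:E)%E =
  ((b ^+ n.+1 - a ^+ n.+1) / n.+1%:R)%:E.
Proof.
have H c d : c <= d -> (\int[mu]_u (monomial_strip n c d u)%:E)%E =
    ((d ^+ n.+1 - c ^+ n.+1) / n.+1%:R)%:E.
  move=> cd.
  transitivity (\int[mu]_(u in `[c, d[) (u ^+ n)%:E)%E.
    rewrite [RHS]integral_mkcond -[in RHS](monomial_stripE n cd).
    by [].
  rewrite integral_itv_bndo_bndc; last first.
    apply/measurable_EFinP; apply: measurable_funTS.
    by apply: continuous_measurable_fun; exact: continuous_monomial.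
  move: cd; rewrite le_eqVlt => /predU1P[->|cd].
    by rewrite subrr mul0r set_itv1 integral_set1.
  have n0 : n.+1%:R != 0 :> R by rewrite pnatr_eq0.
  pose F u : R := n.+1%:R^-1 *: (u : R^o) ^+ n.+1.
  have cF : continuous F.
    by move=> u; apply: cvgZl_tmp; exact: continuous_monomial.
  have dF : {in `]c, d[, F^`()%classic =1 (fun u => u ^+ n)}.
    move=> u _; rewrite derive1E (@deriveZ _ _ _ (fun u : R => u ^+ n.+1)); last first.
      exact: exprn_derivable.
    rewrite -derive1E exp_derive1 scalerA mulVf ?scale1r//.
  have FTC := continuous_FTC2 cd (continuous_subspaceT (@continuous_monomial n)) _ dF.
  apply: etrans (FTC _) _.
    split; first by move=> u _; apply: derivableZ; exact: exprn_derivable.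
      by apply: cvg_at_right_filter; exact: cF.
    by apply: cvg_at_left_filter; exact: cF.
  by rewrite /F -EFinB -scalerBr [_ *: _]mulrC.
have [|/ltW ba] := leP a b; first exact: H.
under eq_integral do rewrite monomial_strip_sym.
under eq_integral do rewrite EFinN.
rewrite integralN/=; last first.
  exact: integrable_add_def (integrable_monomial_strip n b a).
by rewrite H// -EFinN -mulNr opprB.
Qed.

Lemma integral_abs_monomial_strip n a b M : `|a| <= M -> `|b| <= M ->
  (\int[mu]_u `|monomial_strip n a b u|%:E <= (M ^+ n * `|b - a|)%:E)%E.
Proof.
have H c d : c <= d -> `|c| <= M -> `|d| <= M ->
    (\int[mu]_u `|monomial_strip n c d u|%:E <= (M ^+ n * `|d - c|)%:E)%E.
  move=> cd cM dM.
  apply: (@le_trans _ _ (\int[mu]_u ((M ^+ n)%:E * (monomial_strip 0 c d u)%:E))%E).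
    apply: ge0_le_integral => //.
    - apply/measurable_EFinP; apply: measurableT_comp => //.
      by have /measurable_int/measurable_EFinP := integrable_monomial_strip n c d.
    - apply: measurable_funeM.
      by have /measurable_int := integrable_monomial_strip 0 c d.
    - move=> u _; rewrite -EFinM lee_fin /monomial_strip expr0 mul1r.
      rewrite step_diff// indicE mem_setE in_itv/=.
      case: (boolP (c <= u < d)) => [/andP[cu ud]|_] /=; last by rewrite !mulr0 normr0.
      rewrite !mulr1 normrX lerXn2r ?nnegrE//.
        exact: le_trans dM.
      rewrite ler_norml; move: cM dM; rewrite !ler_norml => /andP[? ?] /andP[? ?].
      by apply/andP; split; lra.
  rewrite integralZl//; last exact: integrable_monomial_strip.
  rewrite integral_monomial_strip !expr1 divr1 -EFinM ger0_norm// subr_ge0//.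
have [|/ltW ba] := leP a b; first exact: H.
move=> aM bM; under eq_integral do rewrite monomial_strip_sym normrN.
by rewrite distrC; exact: H.
Qed.

End half_line_indicators.

Section tensor_product_functions.
Variable R : realType.
Local Notation mu := (@lebesgue_measure R).
Variables f g : R -> R.
Hypothesis fi : mu.-integrable setT (EFin \o f).
Hypothesis gi : mu.-integrable setT (EFin \o g).

Let mf : measurable_fun setT f.
Proof. by have /measurable_int/measurable_EFinP := fi. Qed.

Let mg : measurable_fun setT g.
Proof. by have /measurable_int/measurable_EFinP := gi. Qed.

Lemma measurable_tensor : measurable_fun setT (fun z : R * R => f z.1 * g z.2).
Proof.
apply: measurable_funM.
  exact: measurableT_comp mf measurable_fst.
exact: measurableT_comp mg measurable_snd.
Qed.

Lemma integral_abs_tensor :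
  (\int[mu \x mu]_z `|f z.1 * g z.2|%:E =
   (\int[mu]_u `|f u|%:E) * (\int[mu]_u `|g u|%:E))%E.
Proof.
rewrite fubini_tonelli1/=; last 2 first.
- by apply/measurable_EFinP; apply: measurableT_comp => //; exact: measurable_tensor.
- by move=> z; rewrite lee_fin.
rewrite /fubini_F/=.
under eq_integral => u _.
  under eq_integral do rewrite normrM EFinM.
  rewrite ge0_integralZl//; last by apply/measurable_EFinP; exact: measurableT_comp.
  over.
rewrite ge0_integralZr//; first by apply/measurable_EFinP; exact: measurableT_comp.
by apply: integral_ge0 => *; rewrite lee_fin.
Qed.

Lemma integrable_tensor :
  (mu \x mu)%E.-integrable setT (fun z : R * R => (f z.1 * g z.2)%:E).
Proof.
apply/integrableP; split; first by apply/measurable_EFinP; exact: measurable_tensor.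
have /integrableP[_ fo] := fi; have /integrableP[_ go] := gi.
have := integral_abs_tensor.
under eq_integral do rewrite -abse_EFin.
move=> ->; apply: lte_mul_pinfty => //.
  by apply: integral_ge0 => *; rewrite lee_fin.
by rewrite fin_num_abs gee0_abs//; apply: integral_ge0 => *; rewrite lee_fin.
Qed.

Lemma integral_tensor :
  (\int[mu \x mu]_z (f z.1 * g z.2)%:E =
   (\int[mu]_u (f u)%:E) * (\int[mu]_u (g u)%:E))%E.
Proof.
rewrite -integral12_prod_meas1; last exact: integrable_tensor.
rewrite /fubini_F/=.
under eq_integral => u _.
  under eq_integral do rewrite EFinM.
  rewrite integralZl//.
  over.
have gf : (\int[mu]_u (g u)%:E)%E \is a fin_num by exact: integrable_fin_num.
by rewrite -(fineK gf) integralZr.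
Qed.

End tensor_product_functions.

Lemma integral_L1_limit d (T : measurableType d) (R : realType)
    (mu : {measure set T -> \bar R}) (A : set T) (f_ : nat -> T -> R) (f : T -> R)
    (a : nat -> R) (l : R) :
  measurable A -> mu A = 0%E ->
  (forall m, mu.-integrable setT (EFin \o f_ m)) ->
  (forall z, A z -> f z = 0) ->
  (forall z, ~ A z -> f_ m z @[m --> \oo] --> f z) ->
  (forall e, 0 < e -> exists m0, forall m q, (m0 <= m)%N ->
    (\int[mu]_z `|f_ (m + q)%N z - f_ m z|%:E <= e%:E)%E) ->
  (forall m, (\int[mu]_z (f_ m z)%:E)%E = (a m)%:E) ->
  a m @[m --> \oo] --> l ->
  (\int[mu]_z (f z)%:E)%E = l%:E.
Proof.
move=> mA A0 intf fA f_f f_cauchy f_a al.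
(* Cutting off the null set makes the convergence hold everywhere, since [f] vanishes on [A];
   measurability of [f] follows. *)
pose g m z := f_ m z * \1_(~` A) z.
have mf_ m : measurable_fun setT (f_ m).
  by have /measurable_int/measurable_EFinP := intf m.
have m1 : measurable_fun setT (\1_(~` A) : T -> R).
  by apply: measurable_indic; exact: measurableC.
have mg m : measurable_fun setT (g m) by exact: measurable_funM.
have gle m z : `|g m z| <= `|f_ m z|.
  rewrite /g normrM indicE; case: (_ \in _); rewrite ?normr1 ?mulr1//.
  by rewrite normr0 mulr0.
have g_f z : g m z @[m --> \oo] --> f z.
  have [Az|nAz] := pselect (A z).
    rewrite fA//; rewrite [X in X @ _ --> _](_ : _ = fun=> 0); first exact: cvg_cst.
    by apply/funext => m; rewrite /g indicE memNset ?mulr0//= => /(_ Az).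
  rewrite [X in X @ _ --> _](_ : _ = fun m => f_ m z); first exact: f_f.
  by apply/funext => m; rewrite /g indicE mem_set ?mulr1.
have mf : measurable_fun setT f.
  by apply: (measurable_fun_cvg mg) => z _; exact: g_f.
have intg m : mu.-integrable setT (EFin \o g m).
  apply: (le_integrable measurableT _ _ (intf m)).
    exact/measurable_EFinP.
  by move=> z _; rewrite lee_fin gle.
have int_g m : (\int[mu]_z (g m z)%:E)%E = (a m)%:E.
  rewrite -f_a; apply: ae_eq_integral => //; [exact/measurable_EFinP..|].
  exists A; split=> // z /= h; apply: contrapT => nAz; apply: h => _.
  by rewrite /g indicE mem_set ?mulr1.
(* Fatou's lemma in [q], with [m] fixed, passes the Cauchy estimate to the limit. It yields first
   the integrability of [f], then the convergence of the integrals. *)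
have key e : 0 < e -> exists m0, forall m, (m0 <= m)%N ->
    (\int[mu]_z `|f z - g m z|%:E <= e%:E)%E.
  move=> e0; have [m0 h] := f_cauchy e e0; exists m0 => m m0m.
  pose H q z := `|g (m + q)%N z - g m z|.
  have mH q : measurable_fun setT (H q).
    by apply: measurableT_comp => //; exact: measurable_funB.
  have Hle q : (\int[mu]_z (H q z)%:E <= e%:E)%E.
    apply: le_trans (h m q m0m); apply: ge0_le_integral.
    - exact: measurableT.
    - by move=> z _; rewrite lee_fin /H normr_ge0.
    - exact/measurable_EFinP.
    - by apply/measurable_EFinP; apply: measurableT_comp => //; exact: measurable_funB.
    - move=> z _; rewrite lee_fin /H /g -mulrBl normrM indicE.
      by case: (_ \in _); rewrite ?normr1 ?mulr1// normr0 mulr0.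
  have F := @fatou _ _ _ mu setT measurableT (fun q z => (H q z)%:E)
    (fun q => (measurable_EFinP _ _).2 (mH q)) (fun q z _ => normr_ge0 _).
  rewrite (_ : (\int[mu]_z `|f z - g m z|%:E)%E =
      (\int[mu]_z limn_einf (fun q => (H q z)%:E))%E); last first.
    apply: eq_integral => z _; apply/esym.
    suff : (H q z)%:E @[q --> \oo] --> `|f z - g m z|%:E by move=> /cvg_limn_einf_sup[].
    apply: cvg_EFin; first exact: nearW.
    apply: cvg_norm; apply: cvgB; last exact: cvg_cst.
    under eq_fun do rewrite addnC.
    by have := g_f z; rewrite -(cvg_shiftn m).
  apply: le_trans F _; rewrite limn_einf_lim; apply: lime_le; first exact: is_cvg_einfs.
  apply: nearW => q; apply: le_trans (Hle q).
  by apply: ereal_inf_lbound; exists q => /=.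
have intf_ : mu.-integrable setT (EFin \o f).
  have [m0 /(_ m0 (leqnn _)) h] := key 1 ltr01.
  have : mu.-integrable setT (EFin \o (fun z => f z - g m0 z)).
    apply/integrableP; split; first by apply/measurable_EFinP; exact: measurable_funB.
    by apply: le_lt_trans h _; rewrite ltry.
  move=> /integrableD => /(_ measurableT _ (intg m0)).
  congr (integrable _ _ _); apply/funext => z /=.
  by rewrite -EFinD subrK.
have ff := integrable_fin_num measurableT intf_.
rewrite -(fineK ff); congr EFin; apply: cvg_unique al => //.
apply/cvgrPdist_le => e e0; have [m0 h] := key e e0.
exists m0 => // m /= m0m; have {}h := h m m0m.
rewrite -lee_fin; apply: le_trans h.
have mfg : measurable_fun setT (fun z => (f z)%:E - (g m z)%:E)%E.
  by apply/measurable_EFinP; exact: measurable_funB.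
have := le_abse_integral mu measurableT mfg.
have -> : (\int[mu]_z ((f z)%:E - (g m z)%:E) =
    (fine (\int[mu]_z (f z)%:E) - a m)%:E)%E.
  rewrite (integralB measurableT intf_ (intg m)) EFinB fineK//.
  by congr (_ - _)%E; exact: int_g.
by [].
Qed.

Lemma dyadic_itv (R : realType) (m : nat) (s : R) : 0 <= s -> s <= 1 ->
  exists2 i, (i < 2 ^ m)%N & dyadic m i <= s /\ s <= dyadic m i.+1.
Proof.
move=> s0; rewrite le_eqVlt => /predU1P[->|s1].
  exists (2 ^ m).-1; first by rewrite prednK ?expn_gt0.
  by rewrite prednK ?expn_gt0// dyadic1; split=> //; apply: dyadic_le1; rewrite leq_pred.
have p0 : 0 < 2 ^+ m :> R by rewrite exprn_gt0.
have sp : 0 <= s * 2 ^+ m by rewrite mulr_ge0// ltW.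
have /andP[h1 h2] := truncn_itv sp.
exists (Num.truncn (s * 2 ^+ m)).
  rewrite truncn_lt_nat// natrX -[ltRHS]mul1r ltr_pM2r//.
by rewrite /dyadic ler_pdivrMr// ler_pdivlMr//; split => //; exact: ltW.
Qed.

(** * The image of the curve is Lebesgue-null *)

Section curve_image.
Variables (R : realType) (V : R -> R) (th : R) (gamma : R -> R * R).
Hypothesis th1 : 1 < th.
Hypothesis Vmono : forall s t, 0 <= s -> s <= t -> t <= 1 -> V s <= V t.
Hypothesis ug : uniformly_continuous01 gamma.
Hypothesis small : forall e, 0 < e -> exists2 d, 0 < d &
  forall s t, 0 <= s -> s <= t -> t <= 1 -> t - s < d ->
  `|gamma t - gamma s| ^+ 2 <= e * kappa V th s t.

Local Notation mu := (@lebesgue_measure R).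

Definition curve_image : set (R * R) :=
  [set z | exists s, [/\ 0 <= s, s <= 1 & gamma s = z]].

Let box (c : R * R) (r : R) : set (R * R) :=
  `[c.1 - r, c.1 + r]%classic `*` `[c.2 - r, c.2 + r]%classic.

Let boxP c r z : box c r z <-> `|z - c| <= r.
Proof.
rewrite /box /= !in_itv/= prod_normE ge_max !ler_norml /=; split.
  by case=> /andP[? ?] /andP[? ?]; apply/andP; split; apply/andP; split; lra.
move=> /andP[/andP[? ?] /andP[? ?]]; split; apply/andP; split; lra.
Qed.

Let measurable_box c r : measurable (box c r).
Proof. exact: measurableX. Qed.

Let measure_box c r : 0 <= r -> (mu \x mu)%E (box c r) = (4 * r ^+ 2)%:E.
Proof.
move=> r0.
have M a : lebesgue_measure (`[a - r, a + r]%classic : set R) = (2 * r)%:E.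
  rewrite lebesgue_measure_itv /= lte_fin.
  have [->|rn0] := eqVneq r 0; first by rewrite subr0 addr0 ltxx mulr0.
  have {}r0 : 0 < r by rewrite lt0r rn0.
  by rewrite ifT; [rewrite -EFinB; congr EFin; ring|lra].
rewrite /box product_measure1E//.
apply: etrans (congr2 mule (M c.1) (M c.2)) _.
by rewrite -EFinM; congr EFin; ring.
Qed.

(** Each dyadic arc lies in a square whose area is a small multiple of its [kappa], and these sum to
    at most [kappa 0 1]. Closeness of [E] to the curve serves to recover the image as an
    intersection of covers. *)
Lemma curve_cover e : 0 < e -> exists E : set (R * R),
  [/\ measurable E, curve_image `<=` E, ((mu \x mu)%E E <= e%:E)%E &
    forall z, E z -> exists s, [/\ 0 <= s, s <= 1 & `|z - gamma s| <= e]].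
Proof.
move=> e0; have k0 := kappa_ge0 V th 0 1.
(* The bound by [e] limits the total area, the bound by [e ^+ 2] the radii; 4 is the area of a
   square of radius 1. *)
set e1 := Num.min e (e ^+ 2) / (4 * (kappa V th 0 1 + 1)).
have C0 : 0 < 4 * (kappa V th 0 1 + 1) by rewrite mulr_gt0// ltr_wpDl.
have me0 : 0 < Num.min e (e ^+ 2) by rewrite lt_min e0 exprn_gt0.
have e10 : 0 < e1 by rewrite divr_gt0.
have e1k k : 0 <= k -> k <= kappa V th 0 1 ->
    4 * (e1 * k) <= e /\ e1 * k <= e ^+ 2.
  move=> k_ge0 kk; have : 4 * (e1 * k) <= Num.min e (e ^+ 2).
    rewrite mulrCA /e1 mulrAC ler_pdivrMr// ler_wpM2l ?(ltW me0)//.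
    by rewrite ler_wpM2l//; lra.
  rewrite le_min => /andP[h1 h2]; split => //.
  by have := mulr_ge0 (ltW e10) k_ge0; lra.
have [d d0 h] := small e10; have [m0 /(_ m0 (leqnn _)) m0d] := dyadic_small d0.
set m := m0 in m0d.
pose k i := kappa V th (dyadic m i) (dyadic m i.+1).
pose r i := Num.sqrt (e1 * k i).
have ek i : 0 <= e1 * k i by rewrite mulr_ge0 ?kappa_ge0// ltW.
have r2 i : r i ^+ 2 = e1 * k i by rewrite sqr_sqrtr.
pose bx i := box (gamma (dyadic m i)) (r i).
pose E := \big[setU/set0]_(i < 2 ^ m) bx i.
exists E; split.
- by apply: bigsetU_measurable => i _; exact: measurable_box.
- move=> _ [s [s0 s1 <-]]; have [i im [i1 i2]] := dyadic_itv m s0 s1.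
  rewrite /E -(bigcup_mkord _ bx); exists i => //; apply/boxP.
  rewrite -(@ler_pXn2r _ 2%N)// ?nnegrE ?sqrtr_ge0// r2.
  apply: le_trans (h (dyadic m i) s (dyadic_ge0 _ _ _) i1 s1 _) _.
    by apply: le_lt_trans m0d; rewrite -(dyadic_step R m i); lra.
  apply: ler_wpM2l; first exact: ltW.
  by apply: (kappa_mono th1 Vmono) => //; [exact: dyadic_ge0|exact: dyadic_le1].
- apply: le_trans (@Boole_inequality _ _ _ (mu \x mu)%E bx (2 ^ m) _) _.
    by move=> i _; exact: measurable_box.
  rewrite (eq_bigr (fun i : 'I_(2 ^ m) => (4 * (e1 * k i))%:E)); last first.
    by move=> i _; rewrite -r2; apply: measure_box; exact: sqrtr_ge0.
  rewrite sumEFin lee_fin -mulr_sumr -mulr_sumr -(big_mkord xpredT k).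
  apply: (e1k _ _ _).1; first by apply: sumr_ge0 => i _; exact: kappa_ge0.
  apply: (sum_kappa_le th1 Vmono (dyadic_ge0 _ _ _) _ (dyadic_le1 _ (leqnn _))).
  by move=> i _; exact: dyadic_le.
- move=> z; rewrite /E -(bigcup_mkord _ bx) => -[i /= im /boxP zi].
  exists (dyadic m i); split; [exact: dyadic_ge0|exact/dyadic_le1/ltnW|].
  apply: le_trans zi _; rewrite -(@ler_pXn2r _ 2%N)// ?nnegrE ?sqrtr_ge0 ?(ltW e0)//.
  rewrite r2; apply: (e1k _ _ _).2; first exact: kappa_ge0.
  by apply: (kappa_mono th1 Vmono) => //; [exact: dyadic_ge0|exact: dyadic_le|
    exact: dyadic_le1].
Qed.

(** A point off the curve has positive distance to it and so leaves the covers eventually; the image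
    is thus a countable intersection of measurable sets of arbitrarily small measure. *)
Lemma curve_image_null : measurable curve_image /\ (mu \x mu)%E curve_image = 0%E.
Proof.
have /choice[E HE] : forall j : nat, exists E : set (R * R),
    [/\ measurable E, curve_image `<=` E, ((mu \x mu)%E E <= (j.+1%:R^-1)%:E)%E &
    forall z, E z -> exists s, [/\ 0 <= s, s <= 1 & `|z - gamma s| <= j.+1%:R^-1]].
  by move=> j; apply: curve_cover; rewrite invr_gt0.
have mE : measurable (\bigcap_j E j).
  by apply: bigcapT_measurable => j; have [] := HE j.
have IE : curve_image = \bigcap_j E j.
  apply/seteqP; split=> [z zI j _|z zE]; first by have [_ h _ _] := HE j; exact: h.
  apply: contrapT => nz.
  have gz s : 0 <= s -> s <= 1 -> gamma s != z.
    by move=> s0 s1; apply/eqP => gsz; apply: nz; exists s.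
  have [d d0 hd] := distance_to_curve ug gz.
  have [j jd] : exists j : nat, j.+1%:R^-1 < d.
    by exists (Num.truncn d^-1); rewrite invf_plt ?posrE// truncnS_gt.
  have [_ _ _ /(_ z (zE j I)) [s [s0 s1 zs]]] := HE j.
  have := hd s; rewrite clamp01_id// distrC leNgt => /negP; apply.
  exact: le_lt_trans zs jd.
split; first by rewrite IE.
apply/eqP; rewrite eq_le measure_ge0 andbT.
apply/lee_addgt0Pr => e e0; rewrite add0e.
have [j je] : exists j : nat, j.+1%:R^-1 < e.
  by exists (Num.truncn e^-1); rewrite invf_plt ?posrE// truncnS_gt.
have [mEj _ h _] := HE j; rewrite IE.
apply: le_trans (_ : ((mu \x mu)%E (E j) <= _)%E).
  by apply: le_measure; rewrite ?inE//; exact: bigcap_inf.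
by apply: le_trans h _; rewrite lee_fin ltW.
Qed.

End curve_image.

(** * Weighted crossing numbers of staircases in L^1 *)

Section staircase.
Variables (R : realType) (V : R -> R) (th : R) (x y : R -> R).
Hypothesis th1 : 1 < th.
Hypothesis Vmono : forall s t, 0 <= s -> s <= t -> t <= 1 -> V s <= V t.
Hypotheses (bx : bounded01 x) (by_ : bounded01 y).
Hypothesis xy : compatible V th x y.
Hypothesis y01 : y 0 = y 1.
Variables n k : nat.

Local Notation mu := (@lebesgue_measure R).

(* Weighted contribution of the vertical edge from [(x s, y s)] to [(x s, y t)]
   to the crossings of the horizontal ray from [z] to the right. *)
Definition edge (s t : R) : R * R -> R := fun z =>
  z.1 ^+ n * z.2 ^+ k * ((step (y t) z.2 - step (y s) z.2) * step (x s) z.1).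

Definition staircase (m : nat) : R * R -> R :=
  \sum_(0 <= i < 2 ^ m) edge (dyadic m i) (dyadic m i.+1).

Definition rectangle (a b c d : R) : R * R -> R := fun z =>
  monomial_strip n a b z.1 * monomial_strip k c d z.2.

Lemma edge_delta s r t :
  edge s r + edge r t - edge s t = rectangle (x s) (x r) (y r) (y t).
Proof.
apply/funext => z; rewrite !fctE /edge /rectangle /monomial_strip.
by ring.
Qed.

Lemma integrable_rectangle a b c d :
  (mu \x mu)%E.-integrable setT (EFin \o rectangle a b c d).
Proof. by apply: integrable_tensor; exact: integrable_monomial_strip. Qed.

(** An edge lives on a horizontal strip unbounded to the left. As [y 0 = y 1], the increments in [y]
    telescope to 0, so [step 0 z.1] may be subtracted from each horizontal factor, leaving bounded
    rectangles. *)
Lemma staircase_rectangles m : staircase m =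
  \sum_(0 <= i < 2 ^ m) rectangle 0 (x (dyadic m i)) (y (dyadic m i)) (y (dyadic m i.+1)).
Proof.
apply/funext => z; rewrite /staircase !fct_sumE; apply/eqP; rewrite -subr_eq0.
rewrite -sumrB (eq_bigr (fun i => z.1 ^+ n * z.2 ^+ k * step 0 z.1 *
    (step (y (dyadic m i.+1)) z.2 - step (y (dyadic m i)) z.2))); last first.
  by move=> i _; rewrite /edge /rectangle /monomial_strip; ring.
rewrite -mulr_sumr (telescope_sumr (fun i => step (y (dyadic m i)) z.2))//.
by rewrite dyadic0 dyadic1 y01 subrr mulr0.
Qed.

Lemma staircaseE m z : staircase m z =
  \sum_(0 <= i < 2 ^ m) rectangle 0 (x (dyadic m i)) (y (dyadic m i)) (y (dyadic m i.+1)) z.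
Proof. by rewrite staircase_rectangles fct_sumE. Qed.

Lemma integrable_staircase m :
  (mu \x mu)%E.-integrable setT (EFin \o staircase m).
Proof.
rewrite [X in _.-integrable _ X](_ : _ = fun z => (\sum_(0 <= i < 2 ^ m)
   (rectangle 0 (x (dyadic m i)) (y (dyadic m i)) (y (dyadic m i.+1)) z)%:E)%E).
  by apply: integrable_sum => // i _; exact: integrable_rectangle.
by apply/funext => z /=; rewrite staircaseE sumEFin.
Qed.

Lemma integral_staircase m : (\int[mu \x mu]_z (staircase m z)%:E)%E =
  (\sum_(0 <= i < 2 ^ m) x (dyadic m i) ^+ n.+1 / n.+1%:R *
    ((y (dyadic m i.+1) ^+ k.+1 - y (dyadic m i) ^+ k.+1) / k.+1%:R))%:E.
Proof.
under eq_integral do rewrite staircaseE -sumEFin.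
rewrite integral_sum//; last by move=> i; exact: integrable_rectangle.
rewrite -sumEFin; apply: eq_bigr => i _.
rewrite integral_tensor; [|exact: integrable_monomial_strip..].
by rewrite !integral_monomial_strip -EFinM expr0n subr0.
Qed.

(** Sewing with the L^1 norm on the plane. Single edges need not be integrable, but only their
    defects enter, and these are weighted rectangles. *)
Lemma staircase_cauchy e : 0 < e -> exists m0, forall m q, (m0 <= m)%N ->
  (\int[mu \x mu]_z `|staircase (m + q) z - staircase m z|%:E <= e%:E)%E.
Proof.
move=> e0; have [M M0 xM] := bx; have [M' M'0 yM] := by_.
have K0 := young_const_ge0 th1; have k0 := kappa_ge0 V th 0 1.
pose C := M ^+ n * M' ^+ k.
have C0 : 0 <= C by rewrite mulr_ge0 ?exprn_ge0 ?ltW.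
have D0 : 0 < C * (young_const th * kappa V th 0 1) + 1.
  by rewrite ltr_wpDl//; exact: mulr_ge0 C0 (mulr_ge0 K0 k0).
have e'0 := divr_gt0 e0 D0; set e' := e / _ in e'0.
have [d d0 dxy] := xy e'0.
have [m0 m0d] := dyadic_small d0; exists m0 => m q m0m.
pose B (f : R * R -> R) (r : R) := measurable_fun setT f /\
  (\int[mu \x mu]_z `|f z|%:E <= r%:E)%E.
have mabs (f : R * R -> R) : measurable_fun setT f ->
    measurable_fun setT (fun z => `|f z|%:E).
  by move=> mf; apply/measurable_EFinP; exact: measurableT_comp.
have B0 : B 0 0.
  split; first exact: measurable_cst.
  by rewrite integral0_eq// => z _; rewrite normr0.
have BD v v' r r' : B v r -> B v' r' -> B (v + v') (r + r').
  move=> [mv vr] [mv' vr']; split; first exact: measurable_funD.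
  rewrite EFinD; apply: le_trans (leeD vr vr').
  rewrite -ge0_integralD//; try exact: mabs.
  apply: ge0_le_integral => //.
  - by apply: mabs; exact: measurable_funD.
  - by apply: emeasurable_funD; exact: mabs.
  - by move=> z _; rewrite -EFinD lee_fin; exact: ler_normD.
have Ble v r r' : B v r -> r <= r' -> B v r'.
  by move=> [mv vr] rr'; split => //; apply: le_trans vr _; rewrite lee_fin.
have c0 : 0 <= C * e' by rewrite mulr_ge0// ltW.
have := @sewing_refine R V th th1 Vmono _ B edge _ d (2 ^ m) (2 ^ q)
  (dyadic (m + q)) c0 B0 BD Ble.
rewrite -expnD; under [X in _ - X]eq_bigr do rewrite !dyadic_refine.
move=> h; have [||||||_] := h _ _ _ _ _ _.
- move=> s; apply/funext => z; rewrite /edge subrr mul0r mulr0//.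
- move=> s r t s0 sr rt t1 std; rewrite edge_delta; split.
    by have /measurable_int/measurable_EFinP := integrable_rectangle (x s) (x r) (y r) (y t).
  rewrite integral_abs_tensor; [|exact: integrable_monomial_strip..].
  have r0 := le_trans s0 sr; have r1 := le_trans rt t1.
  apply: (@le_trans _ _ ((M ^+ n * `|x r - x s|)%:E * (M' ^+ k * `|y t - y r|)%:E)%E).
    apply: lee_pmul.
    - by apply: integral_ge0 => z _; rewrite lee_fin.
    - by apply: integral_ge0 => z _; rewrite lee_fin.
    - apply: integral_abs_monomial_strip; apply: xM => //.
      exact: le_trans r1.
    - apply: integral_abs_monomial_strip; apply: yM => //.
      exact: le_trans rt.
  rewrite -EFinM lee_fin mulrACA -/C -(mulrA C e') ler_wpM2l//.
  by apply: dxy.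
- exact: dyadic_le.
- exact: dyadic_ge0.
- exact: dyadic_le1.
- move=> i im; rewrite !dyadic_refine dyadic_step; exact: m0d.
move=> H; apply: le_trans H _; rewrite lee_fin.
have -> : C * e' * young_const th * kappa V th 0 1 =
    e * (C * (young_const th * kappa V th 0 1)) /
    (C * (young_const th * kappa V th 0 1) + 1) by rewrite /e'; ring.
rewrite ler_pdivrMr// ler_wpM2l//; first exact: ltW.
by rewrite lerDl.
Qed.

End staircase.

(** * Comparison of the signature with the integral of the winding number *)

Lemma uniformly_continuous01_bounded (R : realType) (gamma : R -> R * R) :
  uniformly_continuous01 gamma ->
  exists M, forall t, 0 <= t -> t <= 1 -> `|gamma t| <= M.
Proof.
move=> ug.
have cn : {within `[0, 1], continuous (fun s => `|gamma (clamp01 s)|)}.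
  by apply: continuous_subspaceT => s; apply: cvg_norm; exact: continuous_clamped.
have [c _ h] := EVT_max ler01 cn.
exists `|gamma (clamp01 c)| => t t0 t1.
by have := h t; rewrite in_itv/= t0 t1 clamp01_id// => /(_ isT).
Qed.

(** At [z = gamma s] a lift would have cosine and sine both equal to 0 / 0 = 0, so the default value
    0 is taken. *)
Lemma winding_on_curve (R : realType) (gamma : R -> R * R) (s : R) :
  0 <= s -> s <= 1 -> winding gamma (gamma s) = 0.
Proof.
move=> s0 s1; apply: xgetPN => _ [g [_ gL] _].
have [|c0 d0] := gL s; first by rewrite in_itv/= s0.
have := cos2Dsin2 (g s); rewrite c0 d0 subrr !mul0r expr0n addr0 => /esym/eqP.
by rewrite oner_eq0.
Qed.

Theorem lemma20 (R : realType) (p : R) (gamma : R -> R * R) :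
  1 <= p -> p < 2 ->
  {within `[0, 1], continuous gamma} ->
  gamma 0 = gamma 1 ->
  finite_pvariation p 0 1 gamma ->
  forall n k : nat,
    (dual_word [tuple of nseq n.+1 (0 : 'I_2) ++ nseq k.+1 (1 : 'I_2)]
       (signature gamma 0 1))%:E =
    (((-1) ^+ k / (n`!%:R * k`!%:R))%:E *
     \int[lebesgue_measure \x lebesgue_measure]_(z in [set: R * R])
       (z.1 ^+ n * z.2 ^+ k *
        winding (fun s => gamma s - gamma 0)%R z)%:E)%E.
Proof.
move=> p1 p2 cg g01 vg n k.
have ug := within_continuous_uniform cg.
pose V := pvariation_upto p gamma; pose th := young_exponent p.
have th1 : 1 < th := young_exponent_gt1 p1 p2.
have Vm := pvariation_upto_mono p1 vg : forall s t, 0 <= s -> s <= t -> t <= 1 ->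
  V s <= V t.
have small := increment_small p1 p2 ug vg.
pose c s := gamma s - gamma 0.
have cB s t : c t - c s = gamma t - gamma s.
  by rewrite /c opprB addrA subrK.
have uc : uniformly_continuous01 c.
  move=> e e0; have [d d0 h] := ug e e0; exists d => // s t s0 s1 t0 t1 std.
  by rewrite cB; exact: h.
have smallc e : 0 < e -> exists2 d, 0 < d & forall s t,
    0 <= s -> s <= t -> t <= 1 -> t - s < d ->
    `|c t - c s| ^+ 2 <= e * kappa V th s t.
  move=> e0; have [d d0 h] := small e e0; exists d => // s t s0 st t1 std.
  by rewrite cB; exact: h.
pose x s := (c s).1; pose y s := (c s).2.
have xle s t : `|x t - x s| <= `|gamma t - gamma s|.
  by rewrite -cB prod_normE le_max lexx.
have yle s t : `|y t - y s| <= `|gamma t - gamma s|.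
  by rewrite -cB prod_normE le_max lexx orbT.
have comp f g := @compatible_coordinates _ p gamma p1 p2 ug vg f g.
have xx : compatible V th x x by apply: comp => *; exact: xle.
have xy : compatible V th x y by apply: comp => *; [exact: xle|exact: yle].
have yy : compatible V th y y by apply: comp => *; exact: yle.
have [M cM] := uniformly_continuous01_bounded uc.
have M0 : 0 < `|M| + 1 by rewrite ltr_wpDl.
have bx : bounded01 x.
  exists (`|M| + 1) => // t t0 t1; apply: (@le_trans _ _ `|c t|).
    by rewrite prod_normE le_max lexx.
  by apply: le_trans (cM t t0 t1) _; have := ler_norm M; lra.
have by_ : bounded01 y.
  exists (`|M| + 1) => // t t0 t1; apply: (@le_trans _ _ `|c t|).
    by rewrite prod_normE le_max lexx orbT.
  by apply: le_trans (cM t t0 t1) _; have := ler_norm M; lra.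
have c0 : c 0 = 0 by rewrite /c subrr.
have c1 : c 1 = 0 by rewrite /c g01 subrr.
have y1 : y 1 = 0 by rewrite /y c1.
have y01 : y 0 = y 1 by rewrite /y c0 c1.
have lim := @signature_limit _ V th th1 Vm gamma x y (fun _ _ _ => erefl)
  (fun _ _ _ => erefl) bx by_ xx xy yy n k y1.
have [mI I0] := curve_image_null th1 Vm uc smallc.
pose f (z : R * R) := z.1 ^+ n * z.2 ^+ k * winding c z.
have fI z : curve_image c z -> f z = 0.
  by move=> [s [s0 s1 <-]]; rewrite /f winding_on_curve// mulr0.
have f_f z : ~ curve_image c z -> staircase x y n k m z @[m --> \oo] --> f z.
  move=> nz.
  have gz s : 0 <= s -> s <= 1 -> c s != z.
    by move=> s0 s1; apply/eqP => csz; apply: nz; exists s.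
  have [m0 h] := winding_crossing uc gz (etrans c0 (esym c1)).
  (* For fixed [z] the sequence is eventually constant, and each edge is definitionally the weighted
     crossing. *)
  apply: cvg_near_cst; exists m0 => // m /= m0m.
  rewrite /f (h m m0m) mulr_sumr /staircase fct_sumE.
  by apply: eq_bigr.
have := @integral_L1_limit _ _ R (lebesgue_measure \x lebesgue_measure)%E _ _ _ _ _
  mI I0 (integrable_staircase x y01 n k) fI f_f
  (staircase_cauchy th1 Vm bx by_ xy n k) (integral_staircase x y01 n k) lim.
rewrite dual_wordE ffunE => ->.
rewrite -EFinM; congr EFin; rewrite /=.
move: (iterated_integral _ _ _ _) (sqrr_sign R k) => J.
move: ((-1) ^+ k) => sg s2.
(* The limit carries (-1)^k and so does the prefactor; the two signs multiply to 1. *)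
transitivity (J * sg ^+ 2); first by rewrite s2 mulr1.
field.
by rewrite !pnatr_eq0 -!lt0n !fact_gt0.
Qed.
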